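(* Let $(M,g)$, $n=\dim M\geq4$, be a semi-Riemannian manifold. (i) The following identity holds on $M$: $$C\cdot R+R\cdot C=R\cdot R+C\cdot C-\frac1{(n-2)^2}\,Q\Big(g,-\frac{\kappa}{n-1}\,g\wedge S+g\wedge S^2\Big).$$ (ii) If $R\cdot R-Q(S,R)=L\,Q(g,C)$ on ${\mathcal U}_C\subset M$ for some function $L$, then on ${\mathcal U}_C$ $$C\cdot R+R\cdot C=Q(S,C)+L\,Q(g,C)+C\cdot C-\frac1{(n-2)^2}\,Q\Big(g,\frac{n-2}2\,S\wedge S-\kappa\,g\wedge S+g\wedge S^2\Big).$$ (iii) If $R\cdot R-Q(S,R)=L\,Q(g,C)$ and $C\cdot C=L_C\,Q(g,C)$ on ${\mathcal U}_C\subset M$ for some functions $L$ and $L_C$, then on ${\mathcal U}_C$ $$C\cdot R+R\cdot C=Q(S,C)+(L+L_C)\,Q(g,C)-\frac1{(n-2)^2}\,Q\Big(g,\frac{n-2}2\,S\wedge S-\kappa\,g\wedge S+g\wedge S^2\Big).$$ (iv) If $(M,g)$ is non-Einstein and non-conformally flat and on ${\mathcal U}_S\cap{\mathcal U}_C\subset M$ the conditions $\mathrm{rank}(S-\alpha g)=1$ (for some function $\alpha$), $R\cdot R-Q(S,R)=L\,Q(g,C)$ and $C\cdot C=L_C\,Q(g,C)$ hold for some functions $L$ and $L_C$, then on ${\mathcal U}_S\cap{\mathcal U}_C$ $$C\cdot R+R\cdot C=Q(S,C)+(L+L_C)\,Q(g,C).$$ (v) On the Gödel spacetime $$C\cdot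 R+R\cdot C=Q(S,C)+\frac\kappa6\,Q(g,C).$$
   Context: All manifolds are connected, paracompact and of class $C^\infty$. For a semi-Riemannian manifold $(M,g)$, $n=\dim M$, with Levi-Civita connection $\nabla$: ${\mathcal R}(X,Y)Z=\nabla_X\nabla_YZ-\nabla_Y\nabla_XZ-\nabla_{[X,Y]}Z$, $R(X_1,X_2,X_3,X_4)=g({\mathcal R}(X_1,X_2)X_3,X_4)$, $S(X,Y)=\mathrm{tr}\{Z\mapsto{\mathcal R}(Z,X)Y\}$, $g({\mathcal S}X,Y)=S(X,Y)$, $S^2(X,Y)=S({\mathcal S}X,Y)$, $\kappa=\mathrm{tr}\,{\mathcal S}$. For symmetric $(0,2)$-tensors $E,F$: $(E\wedge F)(X_1,X_2,X_3,X_4)=E(X_1,X_4)F(X_2,X_3)+E(X_2,X_3)F(X_1,X_4)-E(X_1,X_3)F(X_2,X_4)-E(X_2,X_4)F(X_1,X_3)$; $G=\frac12g\wedge g$; $C=R-\frac1{n-2}g\wedge S+\frac\kappa{(n-2)(n-1)}G$ is the Weyl tensor. For $B\in\{R,C\}$ define ${\mathcal B}$ by $g({\mathcal B}(X_1,X_2)X_3,X_4)=B(X_1,X_2,X_3,X_4)$; for a $(0,k)$-tensor $T$, $(B\cdot T)(X_1,\dots,X_k,X,Y)=-\sum_iT(X_1,\dots,{\mathcal B}(X,Y)X_i,\dots,X_k)$. For a symmetric $(0,2)$-tensor $A$, $(X\wedge_AY)Z=A(Y,Z)X-A(X,Z)Y$ and $Q(A,T)(X_1,\dots,X_k,X,Y)=-\sum_iT(X_1,\dots,(X\wedge_AY)X_i,\dots,X_k)$.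 ${\mathcal U}_S$ is the set of points where $S\ne\frac\kappa ng$; ${\mathcal U}_C$ is the set of points where $C\neq0$. The Gödel spacetime is $\mathbb R^4$ with the metric $ds^2=a^2\big[(dx^0+e^{x^1}dx^2)^2-(dx^1)^2-\frac12e^{2x^1}(dx^2)^2-(dx^3)^2\big]$, $a>0$ a constant. *)

(* Defs.v *)
From HB Require Import structures.
From mathcomp Require Import all_boot all_order all_algebra.
From mathcomp Require Import ring lra.
From mathcomp Require Import all_classical all_reals all_analysis.
Import Order.TTheory GRing.Theory Num.Theory.
Import numFieldNormedType.Exports.

Set Implicit Arguments.
Unset Strict Implicit.
Unset Printing Implicit Defensive.

Local Open Scope classical_set_scope.
Local Open Scope ring_scope.

Section LinearAlgebra.
Variables (R : realType) (n : nat).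
Let V := 'rV[R]_n.

(* (0,2)-, (0,4)- and (0,6)-tensors on a tangent space, identified with R^n by
   a chart.  Sums and scalar multiples of tensors are pointwise. *)
Definition tensor2 := V -> V -> R.
Definition tensor4 := V -> V -> tensor2.
Definition tensor6 := V -> V -> tensor4.

Definition form (g : 'M[R]_n) : tensor2 := fun u v => (u *m g *m v^T) 0 0.

Definition form_mx (A : tensor2) : 'M[R]_n :=
  \matrix_(i, j) A (delta_mx 0 i) (delta_mx 0 j).

(* The vector w with g(w, v) = phi v for all v, if g is nondegenerate and phi
   is linear. *)
Definition sharp (g : 'M[R]_n) (phi : V -> R) : V :=
  (\row_i phi (delta_mx 0 i)) *m invmx g.

Definition trace (f : V -> V) : R := \tr (lin1_mx f).

Definition wedge (E F : tensor2) : tensor4 := fun X1 X2 X3 X4 =>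
  E X1 X4 * F X2 X3 + E X2 X3 * F X1 X4
  - E X1 X3 * F X2 X4 - E X2 X4 * F X1 X3.

(* The action of the endomorphisms E X Y as derivations of the tensor
   algebra. *)
Definition derivation_action (E : V -> V -> V -> V) (T : tensor4) : tensor6 :=
  fun X1 X2 X3 X4 X Y =>
  - (T (E X Y X1) X2 X3 X4 + T X1 (E X Y X2) X3 X4
     + T X1 X2 (E X Y X3) X4 + T X1 X2 X3 (E X Y X4)).

Definition Q (A : tensor2) (T : tensor4) : tensor6 :=
  derivation_action (fun X Y Z => A Y Z *: X - A X Z *: Y) T.

(* The metric and the curvature operator (X, Y, Z) |-> R(X,Y)Z at a point, in
   the coordinates of a chart. *)
Record point_data := PointData { gmx : 'M[R]_n; curv : V -> V -> V -> V }.

Section Curvature.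
Variable D : point_data.

Definition metric : tensor2 := form (gmx D).
Definition riem : tensor4 := fun X1 X2 X3 X4 => metric (curv D X1 X2 X3) X4.
Definition ricci : tensor2 := fun X Y => trace (fun Z => curv D Z X Y).
Definition ricci_op (X : V) : V := sharp (gmx D) (ricci X).
Definition ricci2 : tensor2 := fun X Y => ricci (ricci_op X) Y.
Definition scal : R := trace ricci_op.

Definition weyl : tensor4 :=
  riem - (n%:R - 2)^-1 *: wedge metric ricci
  + (scal / ((n%:R - 2) * (n%:R - 1))) *: (2^-1 *: wedge metric metric).

Definition dot (B T : tensor4) : tensor6 :=
  derivation_action (fun X Y Z => sharp (gmx D) (B X Y Z)) T.

Definition einstein_at : Prop := ricci = (scal / n%:R) *: metric.
End Curvature.
End LinearAlgebra.

Arguments Q {R n}.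
Arguments wedge {R n}.

Section LeviCivita.
Variables (R : realType) (n : nat).
Let V := 'rV[R]_n.
Implicit Types (g : V -> 'M[R]_n) (X Y Z : V -> V).

Fixpoint Ck (k : nat) (U : set V) (f : V -> R) : Prop :=
  (forall x, U x -> {for x, continuous f}) /\
  if k is k'.+1 then
    forall i : 'I_n, (forall x, U x -> derivable f x (delta_mx 0 i)) /\
                     Ck k' U ('D_(delta_mx 0 i) f)
  else True.

Definition smooth (U : set V) (f : V -> R) : Prop := forall k, Ck k U f.

(* In what follows, g is the matrix of components of a metric on an open subset
   of R^n, and X, Y, Z are vector fields on this subset. *)

Definition christoffel g (x u v : V) : V :=
  sharp (g x) (fun w => 2^-1 *
    ('D_u (fun y => form (g y) v w) x + 'D_v (fun y => form (g y) u w) x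
     - 'D_w (fun y => form (g y) u v) x)).

Definition nabla g X Y : V -> V :=
  fun x => 'D_(X x) Y x + christoffel g x (X x) (Y x).

Definition bracket X Y : V -> V := fun x => 'D_(X x) Y x - 'D_(Y x) X x.

Definition curvature g X Y Z : V -> V :=
  nabla g X (nabla g Y Z) - nabla g Y (nabla g X Z) - nabla g (bracket X Y) Z.

(* The curvature at x of tangent vectors u, v, w is computed by extending them
   to vector fields with constant coefficients; by tensoriality, the choice of
   the extensions does not matter. *)
Definition data_at g (x : V) : point_data R n :=
  PointData (g x) (fun u v w => curvature g (cst u) (cst v) (cst w) x).

(* nabla is the Levi-Civita connection of g: it is torsion-free and metric
   (nabla_torsion_free and nabla_metric below). *)

Lemma formE (h : 'M[R]_n) u v :
  form h u v = \sum_j (\sum_i u 0 i * h i j) * v 0 j.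
Proof. by rewrite /form mxE; apply: eq_bigr => j _; rewrite !mxE. Qed.

Lemma formDl (h : 'M[R]_n) u u' v : form h (u + u') v = form h u v + form h u' v.
Proof. by rewrite /form !mulmxDl mxE. Qed.

Lemma formDr (h : 'M[R]_n) u v v' : form h u (v + v') = form h u v + form h u v'.
Proof. by rewrite /form linearD mulmxDr mxE. Qed.

Lemma formZr (h : 'M[R]_n) a u v : form h u (a *: v) = a * form h u v.
Proof. by rewrite /form linearZ -scalemxAr mxE. Qed.

Lemma formDm (h h' : 'M[R]_n) u v : form (h + h') u v = form h u v + form h' u v.
Proof. by rewrite /form mulmxDr mulmxDl mxE. Qed.

Lemma formZm (h : 'M[R]_n) a u v : form (a *: h) u v = a * form h u v.
Proof. by rewrite /form -scalemxAr -scalemxAl mxE. Qed.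

Lemma form_sym (h : 'M[R]_n) u v : h^T = h -> form h u v = form h v u.
Proof.
move=> hs; rewrite /form -[LHS](mxE trmx_key (fun i j => (u *m h *m v^T) j i)).
by rewrite -/(trmx _) !trmx_mul trmxK hs mulmxA.
Qed.

Lemma sharpK (h : 'M[R]_n) (phi : V -> R) w : h \in unitmx ->
  (forall a u v, phi (a *: u + v) = a * phi u + phi v) ->
  form h (sharp h phi) w = phi w.
Proof.
move=> hu phiL; rewrite /form /sharp mulmxKV // mxE.
have phi0 : phi 0 = 0.
  by have := phiL 1 0 0; rewrite scale1r addr0 mul1r => /eqP;
     rewrite -subr_eq0 opprD addrA subrr sub0r oppr_eq0 => /eqP.
have phiS (F : 'I_n -> V) : phi (\sum_i F i) = \sum_i phi (F i).
  elim/big_rec2: _ => // i b c _ <-.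
  by rewrite -{1}[F i]scale1r phiL mul1r.
rewrite [w in RHS]row_sum_delta phiS; apply: eq_bigr => i _.
by rewrite !mxE mulrC -[w 0 i *: _]addr0 phiL phi0 addr0.
Qed.

Lemma is_derive_form g Y Z x v : derivable g x v ->
  derivable Y x v -> derivable Z x v ->
  is_derive x v (fun y => form (g y) (Y y) (Z y))
    (form ('D_v g x) (Y x) (Z x) + form (g x) ('D_v Y x) (Z x)
     + form (g x) (Y x) ('D_v Z x)).
Proof.
move=> dg dY dZ.
have gij i j : is_derive x v (fun y => g y i j) ('D_v g x i j).
  rewrite (derive_mx dg) mxE; apply: derivableP.
  exact: (iffLR (derivable_mxP g x v) dg i j).
have Yi i : is_derive x v (fun y => Y y 0 i) ('D_v Y x 0 i).
  rewrite (derive_mx dY) mxE; apply: derivableP.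
  exact: (iffLR (derivable_mxP Y x v) dY 0 i).
have Zi i : is_derive x v (fun y => Z y 0 i) ('D_v Z x 0 i).
  rewrite (derive_mx dZ) mxE; apply: derivableP.
  exact: (iffLR (derivable_mxP Z x v) dZ 0 i).
have -> : (fun y => form (g y) (Y y) (Z y)) =
    \sum_j ((\sum_i ((fun y => Y y 0 i) * (fun y => g y i j))) *
            (fun y => Z y 0 j)).
  apply/funext => y; rewrite formE fct_sumE; apply: eq_bigr => j _ /=.
  by rewrite /GRing.mul /= fct_sumE.
apply: is_derive_eq; rewrite !formE -!big_split /=; apply: eq_bigr => j _.
rewrite fct_sumE !mulr_suml /GRing.scale /= [_ * \sum_(i < n) _]mulrC.
rewrite !mulr_suml -!big_split /=; apply: eq_bigr => i _.
by rewrite mulrfctE mulrDl [g x i j * _]mulrC addrC.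
Qed.

Section AtPoint.
Variables (g : V -> 'M[R]_n) (x : V).
Hypotheses (dg : differentiable g x) (gs : \forall y \near x, (g y)^T = g y)
  (gu : g x \in unitmx).

Let D u v w : R := 'D_u (fun y => form (g y) v w) x.

Let DE u v w : D u v w = form ('D_u g x) v w.
Proof.
have dgu : derivable g x u by exact: diff_derivable.
have := is_derive_form dgu (derivable_cst v x u) (derivable_cst w x u).
rewrite !derive_cst => -[_]; rewrite /D /= => ->.
by rewrite /form !(mul0mx, trmx0, mulmx0) !mxE !addr0.
Qed.

Let D_sym u v w : D u v w = D u w v.
Proof.
apply: near_eq_derive; near=> y; apply: form_sym; near: y; exact: gs.
Unshelve. all: by end_near. Qed.

Lemma christoffelE u v w : form (g x) (christoffel g x u v) w =
  2^-1 * (D u v w + D v u w - D w u v).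
Proof.
apply: (@sharpK _ (fun w => 2^-1 * (D u v w + D v u w - D w u v))) => //.
move=> a w1 w2; rewrite !DE.
have -> : 'D_(a *: w1 + w2) g x = a *: 'D_w1 g x + 'D_w2 g x.
  by rewrite !deriveE // linearP.
move: ('D_u g x) ('D_v g x) ('D_w1 g x) ('D_w2 g x) => A B C E.
rewrite formDm formZm !formDr !formZr.
move: (form A v w1) (form A v w2) (form B u w1) (form B u w2) => *.
by move: (form C u v) (form E u v) => *; lra.
Qed.

Lemma nabla_torsion_free X Y : nabla g X Y x - nabla g Y X x = bracket X Y x.
Proof.
rewrite /nabla /bracket.
have -> : christoffel g x (X x) (Y x) = christoffel g x (Y x) (X x).
  rewrite /christoffel; congr (sharp _ _); apply/funext => w.
  by congr (2^-1 * (_ - _)); [exact: addrC | exact: D_sym].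
by rewrite opprD addrACA subrr addr0.
Qed.

Lemma nabla_metric X Y Z :
  derivable Y x (X x) -> derivable Z x (X x) ->
  'D_(X x) (fun y => form (g y) (Y y) (Z y)) x =
  form (g x) (nabla g X Y x) (Z x) + form (g x) (Y x) (nabla g X Z x).
Proof.
move=> dY dZ.
have dgx : derivable g x (X x) by exact: diff_derivable.
have [_ ->] := is_derive_form dgx dY dZ.
rewrite /nabla formDl formDr [form _ _ (christoffel _ _ _ _)]form_sym; last first.
  exact: nbhs_singleton gs.
rewrite !christoffelE -DE (D_sym (X x) (Z x)).
move: (D (X x) _ _) (D (Y x) _ _) (D (Z x) _ _) => a b c.
move: (form _ _ _) (form _ _ _) => *; lra.
Qed.

End AtPoint.

End LeviCivita.

Section Manifolds.
Variables (R : realType) (n : nat).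
Let V := 'rV[R]_n.

(* Charts are total functions, whose values are meaningful on cdom only (for
   cmap) and on cimg only (for cinv). *)
Record chart (T : Type) :=
  Chart { cdom : set T; cmap : T -> V; cinv : V -> T }.

Definition cimg (T : Type) (c : chart T) : set V := cmap c @` cdom c.

Definition is_chart (T : topologicalType) (c : chart T) : Prop :=
  [/\ open (cdom c), open (cimg c),
      forall p, cdom c p -> cinv c (cmap c p) = p,
      forall p, cdom c p -> {for p, continuous (cmap c)} &
      forall x, cimg c x -> {for x, continuous (cinv c)}].

Definition transition (T : Type) (c d : chart T) : V -> V := cmap d \o cinv c.

Definition overlap (T : Type) (c d : chart T) : set V :=
  cmap c @` (cdom c `&` cdom d).

Definition paracompact (T : topologicalType) : Prop :=
  forall A : set (set T), A `<=` open -> \bigcup_(U in A) U = setT ->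
  exists B : set (set T),
    [/\ B `<=` open, \bigcup_(W in B) W = setT,
        forall W, B W -> exists2 U, A U & W `<=` U &
        forall p : T, exists2 N : set T, nbhs p N &
          finite_set [set W | B W /\ W `&` N !=set0]].

(* A space with an atlas (indexed by idx) and, for each chart, a matrix of
   functions of the coordinates of this chart. *)
Record charted_metric := ChartedMetric {
  carrier :> topologicalType;
  idx : Type;
  atlas : idx -> chart carrier;
  gcomp : idx -> V -> 'M[R]_n }.
Arguments idx : clear implicits.
Arguments atlas : clear implicits.
Arguments gcomp : clear implicits.

Definition is_manifold (M : charted_metric) : Prop :=
  [/\ hausdorff_space M, connected [set: M], paracompact M,
      (forall i, is_chart (atlas M i)) /\ (forall p, exists i, cdom (atlas M i) p) &
      forall i j k, smooth (overlap (atlas M i) (atlas M j))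
                      (fun x => transition (atlas M i) (atlas M j) x 0 k)].

(* The index of the metric is constant, since M is connected. *)
Definition is_metric (M : charted_metric) : Prop :=
  [/\ forall i x, cimg (atlas M i) x -> (gcomp M i x)^T = gcomp M i x,
      forall i x, cimg (atlas M i) x -> gcomp M i x \in unitmx,
      forall i k l, smooth (cimg (atlas M i)) (fun x => gcomp M i x k l) &
      forall i j x, overlap (atlas M i) (atlas M j) x ->
        let f := transition (atlas M i) (atlas M j) in
        gcomp M i x = 'J f x *m gcomp M j (f x) *m ('J f x)^T].

Definition semi_riemannian (M : charted_metric) : Prop :=
  is_manifold M /\ is_metric M.

(* A tensorial property holds at p if it holds for the components in every
   chart around p. *)
Definition at_point (M : charted_metric) (p : M) (P : point_data R n -> Prop) : Prop :=
  forall i, cdom (atlas M i) p -> P (data_at (gcomp M i) (cmap (atlas M i) p)).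

Definition einstein (M : charted_metric) : Prop :=
  forall p : M, at_point p (fun D => einstein_at D).

Definition conformally_flat (M : charted_metric) : Prop :=
  forall p : M, at_point p (fun D => weyl D = 0).

Definition U_S (M : charted_metric) : set M :=
  [set p | ~ at_point p (fun D => einstein_at D)].

Definition U_C (M : charted_metric) : set M :=
  [set p | ~ at_point p (fun D => weyl D = 0)].

End Manifolds.

Arguments at_point {R n M} p P.
Arguments U_S {R n} M.
Arguments U_C {R n} M.

Section Goedel.
Variables (R : realType) (a : R).

Definition dx (i : 'I_4) : 'rV[R]_4 := delta_mx 0 i.

Definition goedel_metric (x : 'rV[R]_4) : 'M[R]_4 :=
  let e := expR (x 0 1) in
  let sq (w : 'rV[R]_4) := w^T *m w in
  a ^+ 2 *: (sq (dx 0 + e *: dx 2) - sq (dx 1)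
             - (2^-1 * expR (2 * x 0 1)) *: sq (dx 2) - sq (dx 3)).

Definition goedel : charted_metric R 4 :=
  @ChartedMetric R 4 'rV[R]_4 unit
    (fun=> Chart setT id id) (fun=> goedel_metric).

End Goedel.

(* Main.v *)
Require Import Defs.
From HB Require Import structures.
From mathcomp Require Import all_boot all_order all_algebra.
From mathcomp Require Import ring lra.
From mathcomp Require Import all_classical all_reals all_analysis.
Import Order.TTheory GRing.Theory Num.Theory.
Import numFieldNormedType.Exports Defs.

Set Implicit Arguments.
Unset Strict Implicit.
Unset Printing Implicit Defensive.

Local Open Scope classical_set_scope.
Local Open Scope ring_scope.

(** At a point, [C = R - K] where [K] is the wedge product of [g] with a
    combination of [S] and [g], so that bilinearity of [(B, T) |-> B.T] gives
    [C.R + R.C = R.R + C.C - K.K].  The term [K.K] is computed from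
    [(g^S).(g^S) = Q(g, g^S2)], [(g^S).(g^g) = 0] and [(g^g).T = 2 Q(g, T)]; the
    passage from [Q(S, R)] to [Q(S, C)] rests on [Q(S, g^S) = - Q(g, S^S) / 2] and
    [Q(S, g^g) = - 2 Q(g, g^S)].  If [S - alpha g] has rank 1, the tensor in the
    last term of (iii) is a multiple of [g^g], on which [Q(g, -)] vanishes.

    The only geometric input is that the curvature is trilinear and that [S] is
    symmetric.  The first, second and fourth terms of the coordinate expression of
    [S] in the Christoffel symbols are clearly symmetric; the third one is the
    derivative of the trace of the Christoffel symbols, i.e., a second derivative
    of [ln |det g| / 2], and is symmetric by Schwarz's theorem.

    On the Goedel spacetime, [g = h + w*w - z*z] for two 1-forms [w] and [z] and a
    form [h] of rank 2, with [S = k w*w] and [R = k/2 h^(w*w) - k/4 h^h] for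
    [k = 1/a^2].  It follows formally that [kappa = k], [R.R = Q(S, R)],
    [C.C = kappa/6 Q(g, C)], [S^S = 0] and [S2 = kappa S], and (iii) applies. *)

(** * Pointwise algebra *)

Section Tensors.
Variables (R : realType) (n : nat).
Local Notation V := 'rV[R]_n.
Implicit Types (A B : tensor2 R n) (S T U : tensor4 R n) (E F H : V -> V -> V -> V).

Lemma tensor6P (S T : tensor6 R n) :
  (forall X1 X2 X3 X4 X Y, S X1 X2 X3 X4 X Y = T X1 X2 X3 X4 X Y) -> S = T.
Proof. by move=> ST; do 6! (apply/funext => ?); exact: ST. Qed.

(** Linearity is a predicate on bare functions, since [tensor2] and [tensor4] carry no linear
    structure. *)
Definition linear_form (f : V -> R) : Prop :=
  forall a u v, f (a *: u + v) = a * f u + f v.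

Section LinearForm.
Variables (f : V -> R) (fL : linear_form f).

Lemma linear_formD u v : f (u + v) = f u + f v.
Proof. by rewrite -[u]scale1r fL mul1r scale1r. Qed.

Lemma linear_form0 : f 0 = 0.
Proof. by apply: (addrI (f 0)); rewrite -linear_formD !addr0. Qed.

Lemma linear_formZ a u : f (a *: u) = a * f u.
Proof. by rewrite -[a *: u]addr0 fL linear_form0 addr0. Qed.

Lemma linear_form_sum (I : finType) (F : I -> V) :
  f (\sum_i F i) = \sum_i f (F i).
Proof.
by elim/big_rec2: _ => [|i b c _ <-]; [exact: linear_form0 | exact: linear_formD].
Qed.

Lemma linear_formE u : f u = \sum_i u 0 i * f (delta_mx 0 i).
Proof.
rewrite {1}[u]row_sum_delta linear_form_sum.
by apply: eq_bigr => i _; exact: linear_formZ.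
Qed.

End LinearForm.

Record bilinear2 A : Prop := Bilinear2 {
  bilinear2l : forall v, linear_form (A^~ v);
  bilinear2r : forall u, linear_form (A u) }.

Record multilinear4 T : Prop := Multilinear4 {
  multilinear41 : forall v w z, linear_form (fun u => T u v w z);
  multilinear42 : forall u w z, linear_form (fun v => T u v w z);
  multilinear43 : forall u v z, linear_form (fun w => T u v w z);
  multilinear44 : forall u v w, linear_form (T u v w) }.

Lemma wedge_multilinear A B : bilinear2 A -> bilinear2 B ->
  multilinear4 (wedge A B).
Proof.
by move=> [Al Ar] [Bl Br]; split=> *; move=> *;
   rewrite /wedge ?(Al, Ar, Bl, Br); ring.
Qed.

(** The combination [U] enters through its values, so that [weylE], or [erefl] for a tensor defined
    as such a combination, can serve as the hypothesis. *)
Lemma derivation_action_linr E k l S T U :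
  (forall X1 X2 X3 X4, U X1 X2 X3 X4 = k * S X1 X2 X3 X4 + l * T X1 X2 X3 X4) ->
  forall X1 X2 X3 X4 X Y, derivation_action E U X1 X2 X3 X4 X Y =
    k * derivation_action E S X1 X2 X3 X4 X Y
    + l * derivation_action E T X1 X2 X3 X4 X Y.
Proof. by move=> UE *; rewrite /derivation_action !UE; ring. Qed.

Lemma derivation_action_linl k l E F H T : multilinear4 T ->
  (forall X Y Z, H X Y Z = k *: E X Y Z + l *: F X Y Z) ->
  forall X1 X2 X3 X4 X Y, derivation_action H T X1 X2 X3 X4 X Y =
    k * derivation_action E T X1 X2 X3 X4 X Y
    + l * derivation_action F T X1 X2 X3 X4 X Y.
Proof.
move=> [T1 T2 T3 T4] HE *; rewrite /derivation_action !HE.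
rewrite (T1 _ _ _ k) (T2 _ _ _ k) (T3 _ _ _ k) (T4 _ _ _ k).
rewrite (linear_formZ (T1 _ _ _)) (linear_formZ (T2 _ _ _)).
by rewrite (linear_formZ (T3 _ _ _)) (linear_formZ (T4 _ _ _)); ring.
Qed.

Lemma QE A T X1 X2 X3 X4 X Y : multilinear4 T ->
  Q A T X1 X2 X3 X4 X Y =
  A X X1 * T Y X2 X3 X4 - A Y X1 * T X X2 X3 X4
  + A X X2 * T X1 Y X3 X4 - A Y X2 * T X1 X X3 X4
  + A X X3 * T X1 X2 Y X4 - A Y X3 * T X1 X2 X X4
  + A X X4 * T X1 X2 X3 Y - A Y X4 * T X1 X2 X3 X.
Proof.
move=> [T1 T2 T3 T4]; rewrite /Q /derivation_action -!(scaleNr _ Y).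
rewrite (T1 _ _ _ (A Y X1)) (T2 _ _ _ (A Y X2)) (T3 _ _ _ (A Y X3)).
rewrite (T4 _ _ _ (A Y X4)) (linear_formZ (T1 _ _ _)) (linear_formZ (T2 _ _ _)).
by rewrite (linear_formZ (T3 _ _ _)) (linear_formZ (T4 _ _ _)); ring.
Qed.

Lemma form_bilinear (h : 'M[R]_n) : bilinear2 (form h).
Proof.
split=> u a v w; first by rewrite /form mulmxDl mulmxDl -!scalemxAl !mxE.
by rewrite formDr formZr.
Qed.

Lemma sharp_linear (h : 'M[R]_n) k l (phi psi chi : V -> R) :
  (forall u, chi u = k * phi u + l * psi u) ->
  sharp h chi = k *: sharp h phi + l *: sharp h psi.
Proof.
move=> chiE; rewrite /sharp !scalemxAl -mulmxDl; congr (_ *m _).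
by apply/rowP => i; rewrite !mxE chiE.
Qed.

Lemma sharp_form (h : 'M[R]_n) u : h \in unitmx -> sharp h (form h u) = u.
Proof.
move=> hu; rewrite /sharp (_ : \row_i _ = u *m h) ?mulmxK//.
by apply/rowP => i; rewrite mxE /form trmx_delta -colE mxE.
Qed.

End Tensors.

(** * Actions of g ^ g and g ^ S, and the splitting of R into C and a wedge product with g *)

Section Pointwise.
Variables (R : realType) (n : nat) (D : point_data R n).
Local Notation V := 'rV[R]_n.
Local Notation g := (metric D).
Local Notation S := (ricci D).
Local Notation S2 := (ricci2 D).

Hypothesis gs : (gmx D)^T = gmx D.
Hypothesis gu : gmx D \in unitmx.
Hypothesis curvL : multilinear4 (riem D).
Hypothesis SL : bilinear2 (ricci D).
Hypothesis Ss : forall X Y, ricci D X Y = ricci D Y X.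

Let gL : bilinear2 g. Proof. exact: form_bilinear. Qed.
Let gC X Y : g X Y = g Y X. Proof. exact: form_sym. Qed.

Let sharpg X : sharp (gmx D) (g X) = X. Proof. exact: sharp_form. Qed.

Lemma metric_ricci_op X Y : g (ricci_op D X) Y = S X Y.
Proof. by rewrite /metric sharpK //; exact: bilinear2r SL X. Qed.

Lemma ricci_ricci_op X Y : S (ricci_op D X) Y = S2 X Y. Proof. by []. Qed.

Lemma ricci2C X Y : S2 X Y = S2 Y X.
Proof.
by rewrite /ricci2 Ss -metric_ricci_op gC metric_ricci_op Ss.
Qed.

Lemma ricci_op_linear a u v :
  ricci_op D (a *: u + v) = a *: ricci_op D u + ricci_op D v.
Proof.
rewrite -[ricci_op D v]scale1r; apply: sharp_linear => w.
by rewrite mul1r; exact: bilinear2l SL w a u v.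
Qed.

Lemma ricci2_bilinear : bilinear2 S2.
Proof.
split=> u a v w; first by rewrite /ricci2 ricci_op_linear (bilinear2l SL).
by rewrite /ricci2 (bilinear2r SL).
Qed.

Let ggL : multilinear4 (wedge g g). Proof. exact: wedge_multilinear. Qed.
Let gSL : multilinear4 (wedge g S). Proof. exact: wedge_multilinear. Qed.
Let SSL : multilinear4 (wedge S S). Proof. exact: wedge_multilinear. Qed.
Let gS2L : multilinear4 (wedge g S2).
Proof. by apply: wedge_multilinear; last exact: ricci2_bilinear. Qed.

(** [SA] and [SB] are the operators dual to [A] and [B]: the identity for g, [ricci_op] for S. The
    sum is nested because [sharp_linear] splits off one term at a time. *)
Lemma sharp_wedge A B (SA SB : V -> V) X Y Z :
  (forall X, sharp (gmx D) (A X) = SA X) ->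
  (forall X, sharp (gmx D) (B X) = SB X) ->
  sharp (gmx D) (wedge A B X Y Z) =
  B Y Z *: SA X + (A Y Z *: SB X + (- A X Z *: SB Y + - B X Z *: SA Y)).
Proof.
move=> AE BE; rewrite -!AE -!BE.
pose r2 W := - A X Z * B Y W + - B X Z * A Y W.
pose r1 W := A Y Z * B X W + 1 * r2 W.
rewrite (@sharp_linear _ _ _ (B Y Z) 1 (A X) r1).
  rewrite scale1r (@sharp_linear _ _ _ (A Y Z) 1 (B X) r2 r1) // scale1r.
  by rewrite (@sharp_linear _ _ _ (- A X Z) (- B X Z) (B Y) (A Y) r2).
by move=> W; rewrite /wedge /r1 /r2; ring.
Qed.

(** The endomorphisms X ^_g Y are skew for g, so that as derivations they annihilate g and g ^ g. *)
Lemma Q_metric_metric X1 X2 X3 X4 X Y : Q g (wedge g g) X1 X2 X3 X4 X Y = 0.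
Proof.
rewrite QE // /wedge (gC X X1) (gC X X2) (gC X X3) (gC X X4).
by rewrite (gC Y X1) (gC Y X2) (gC Y X3) (gC Y X4); ring.
Qed.

(** Coefficient of t in Q(A, A ^ A) = 0, which holds for every symmetric A, at A = g + t S. *)
Lemma Q_ricci_metric_metric X1 X2 X3 X4 X Y :
  Q S (wedge g g) X1 X2 X3 X4 X Y = - (2 * Q g (wedge g S) X1 X2 X3 X4 X Y).
Proof.
rewrite !QE // /wedge.
rewrite (gC X X1) (gC X X2) (gC X X3) (gC X X4).
rewrite (gC Y X1) (gC Y X2) (gC Y X3) (gC Y X4).
rewrite (Ss X X1) (Ss X X2) (Ss X X3) (Ss X X4).
by rewrite (Ss Y X1) (Ss Y X2) (Ss Y X3) (Ss Y X4); ring.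
Qed.

(** Coefficient of t^2 in the same expansion of Q(A, A ^ A) = 0. *)
Lemma Q_ricci_metric_ricci X1 X2 X3 X4 X Y :
  Q S (wedge g S) X1 X2 X3 X4 X Y = - (2^-1 * Q g (wedge S S) X1 X2 X3 X4 X Y).
Proof.
rewrite !QE // /wedge.
rewrite (gC X X1) (gC X X2) (gC X X3) (gC X X4).
rewrite (gC Y X1) (gC Y X2) (gC Y X3) (gC Y X4).
rewrite (Ss X X1) (Ss X X2) (Ss X X3) (Ss X X4).
by rewrite (Ss Y X1) (Ss Y X2) (Ss Y X3) (Ss Y X4); field.
Qed.

Lemma dot_metric_metric T X1 X2 X3 X4 X Y : multilinear4 T ->
  dot D (wedge g g) T X1 X2 X3 X4 X Y = 2 * Q g T X1 X2 X3 X4 X Y.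
Proof.
(* The endomorphism of g ^ g is twice X ^_g Y, obtained here as a sum of two equal terms. *)
move=> TL; rewrite /dot (@derivation_action_linl _ _ 1 1
  (fun X Y Z => g Y Z *: X - g X Z *: Y) (fun X Y Z => g Y Z *: X - g X Z *: Y)) //.
  by rewrite -/(Q g T); ring.
move=> U V' W; rewrite (sharp_wedge _ _ _ sharpg sharpg) !scale1r !scaleNr.
by rewrite [RHS]addrACA !addrA.
Qed.

Let metric_ricci_opr X Y : g Y (ricci_op D X) = S X Y.
Proof. by rewrite gC metric_ricci_op. Qed.

Let ricci_ricci_opr X Y : S Y (ricci_op D X) = S2 X Y.
Proof. by rewrite Ss. Qed.

(** The endomorphism of g ^ S sends Z to (X ^_S Y) Z plus g(Y, Z) SX - g(X, Z) SY. The first part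
    gives Q(S, T), the second one [d g]. *)
Let dot_metric_ricciE T X1 X2 X3 X4 X Y : multilinear4 T ->
  let d A := A X1 X * T (ricci_op D Y) X2 X3 X4 - A X1 Y * T (ricci_op D X) X2 X3 X4
    + A X2 X * T X1 (ricci_op D Y) X3 X4 - A X2 Y * T X1 (ricci_op D X) X3 X4
    + A X3 X * T X1 X2 (ricci_op D Y) X4 - A X3 Y * T X1 X2 (ricci_op D X) X4
    + A X4 X * T X1 X2 X3 (ricci_op D Y) - A X4 Y * T X1 X2 X3 (ricci_op D X) in
  dot D (wedge g S) T X1 X2 X3 X4 X Y = Q S T X1 X2 X3 X4 X Y + d g.
Proof.
move=> TL; rewrite QE // /dot /derivation_action !(sharp_wedge _ _ _ sharpg (fun=> erefl)).
case: TL => T1 T2 T3 T4 /=.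
rewrite 3!(T1 _ _ _) 3!(T2 _ _ _) 3!(T3 _ _ _) 3!(T4 _ _ _).
rewrite (linear_formZ (T1 _ _ _)) (linear_formZ (T2 _ _ _)).
rewrite (linear_formZ (T3 _ _ _)) (linear_formZ (T4 _ _ _)).
rewrite (gC X X1) (gC X X2) (gC X X3) (gC X X4).
by rewrite (gC Y X1) (gC Y X2) (gC Y X3) (gC Y X4); ring.
Qed.

(** The tensor g ^ S changes sign with the exchange of its last two arguments, so its endomorphisms
    are skew for g and annihilate g ^ g. *)
Lemma dot_metric_ricci_metric X1 X2 X3 X4 X Y :
  dot D (wedge g S) (wedge g g) X1 X2 X3 X4 X Y = 0.
Proof.
rewrite dot_metric_ricciE // QE // /wedge !metric_ricci_op !metric_ricci_opr.
rewrite ?(gC X X1, gC X X2, gC X X3, gC X X4, gC Y X1, gC Y X2, gC Y X3, gC Y X4).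
rewrite ?(Ss X X1, Ss X X2, Ss X X3, Ss X X4, Ss Y X1, Ss Y X2, Ss Y X3, Ss Y X4).
ring.
Qed.

(** By skewness the derivation passes to the factor S. There X ^_S Y contributes Q(S, S) = 0, and
    the remaining part contributes Q(g, S2). *)
Lemma dot_metric_ricci_metric_ricci X1 X2 X3 X4 X Y :
  dot D (wedge g S) (wedge g S) X1 X2 X3 X4 X Y =
  Q g (wedge g S2) X1 X2 X3 X4 X Y.
Proof.
rewrite dot_metric_ricciE // !QE // /wedge !metric_ricci_op !metric_ricci_opr.
rewrite !ricci_ricci_op !ricci_ricci_opr.
rewrite ?(gC X X1, gC X X2, gC X X3, gC X X4, gC Y X1, gC Y X2, gC Y X3, gC Y X4).
rewrite ?(Ss X X1, Ss X X2, Ss X X3, Ss X X4, Ss Y X1, Ss Y X2, Ss Y X3, Ss Y X4).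
rewrite ?(ricci2C X X1, ricci2C X X2, ricci2C X X3, ricci2C X X4).
rewrite ?(ricci2C Y X1, ricci2C Y X2, ricci2C Y X3, ricci2C Y X4).
ring.
Qed.

Local Notation p := ((n%:R - 2)^-1 : R).
Local Notation q := (scal D / ((n%:R - 2) * (n%:R - 1)) / 2).

(** The wedge product of g with the Schouten tensor (S - kappa / (2 (n - 1)) g) / (n - 2), which is
    R - C. *)
Definition schouten_wedge : tensor4 R n := fun X1 X2 X3 X4 =>
  p * wedge g S X1 X2 X3 X4 + - q * wedge g g X1 X2 X3 X4.
Local Notation K := schouten_wedge.

Let KL : multilinear4 K.
Proof.
case: ggL => G1 G2 G3 G4; case: gSL => T1 T2 T3 T4.
split=> X1 X2 X3 k Y1 Y2; rewrite /K.
- by rewrite (G1 _ _ _ k) (T1 _ _ _ k); ring.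
- by rewrite (G2 _ _ _ k) (T2 _ _ _ k); ring.
- by rewrite (G3 _ _ _ k) (T3 _ _ _ k); ring.
- by rewrite (G4 _ _ _ k) (T4 _ _ _ k); ring.
Qed.

(** The coefficients [1] and [- 1] are kept to match the hypotheses of [derivation_action_linr] and
    [dot_linl]. *)
Lemma weylE X1 X2 X3 X4 :
  weyl D X1 X2 X3 X4 = 1 * riem D X1 X2 X3 X4 + - 1 * K X1 X2 X3 X4.
Proof.
by rewrite /weyl /K !fctE /GRing.scale /= /GRing.scale /=; ring.
Qed.

Lemma weyl_multilinear : multilinear4 (weyl D).
Proof.
case: curvL => G1 G2 G3 G4; case: KL => T1 T2 T3 T4.
split=> X1 X2 X3 k Y1 Y2; rewrite !weylE.
- by rewrite (G1 _ _ _ k) (T1 _ _ _ k); ring.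
- by rewrite (G2 _ _ _ k) (T2 _ _ _ k); ring.
- by rewrite (G3 _ _ _ k) (T3 _ _ _ k); ring.
- by rewrite (G4 _ _ _ k) (T4 _ _ _ k); ring.
Qed.

Lemma dot_linl (k l : R) B1 B2 B T : multilinear4 T ->
  (forall X1 X2 X3 X4,
    B X1 X2 X3 X4 = k * B1 X1 X2 X3 X4 + l * B2 X1 X2 X3 X4) ->
  forall X1 X2 X3 X4 X Y, dot D B T X1 X2 X3 X4 X Y =
    k * dot D B1 T X1 X2 X3 X4 X Y + l * dot D B2 T X1 X2 X3 X4 X Y.
Proof.
move=> TL BE; apply: derivation_action_linl => // X Y Z; exact: sharp_linear.
Qed.

(** The subtracted term is K.K. Its part (g ^ S).K reduces to p Q(g, g ^ S2), and its part (g ^ g).K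
    is 2 Q(g, K) = 2 p Q(g, g ^ S). *)
Lemma dot_sum X1 X2 X3 X4 X Y :
  dot D (weyl D) (riem D) X1 X2 X3 X4 X Y + dot D (riem D) (weyl D) X1 X2 X3 X4 X Y
  = dot D (riem D) (riem D) X1 X2 X3 X4 X Y
    + dot D (weyl D) (weyl D) X1 X2 X3 X4 X Y
    - (p ^+ 2 * Q g (wedge g S2) X1 X2 X3 X4 X Y
       - 2 * p * q * Q g (wedge g S) X1 X2 X3 X4 X Y).
Proof.
have WL := weyl_multilinear.
rewrite (dot_linl WL weylE) (dot_linl curvL weylE).
rewrite ![dot D _ (weyl D) _ _ _ _ _ _](derivation_action_linr _ weylE).
rewrite -!/(dot _ _ _) (dot_linl KL (fun _ _ _ _ => erefl)) dot_metric_metric //.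
rewrite [dot D (wedge g S) K _ _ _ _ _ _](derivation_action_linr _ (fun _ _ _ _ => erefl)).
rewrite -!/(dot _ _ _) dot_metric_ricci_metric_ricci dot_metric_ricci_metric.
rewrite [Q g K _ _ _ _ _ _](derivation_action_linr _ (fun _ _ _ _ => erefl)) -!/(Q _ _).
by rewrite Q_metric_metric; ring.
Qed.

End Pointwise.

(** * Bilinear forms of rank 1 as products of two linear forms *)

Section RankOne.
Variable R : realType.

Lemma rank1_outer m n (A : 'M[R]_(m, n)) : \rank A = 1%N ->
  exists x y, forall i j, A i j = x i * y j.
Proof.
(* [col_base] and [row_base] factor [A] through a space of dimension [\rank A], which is rewritten
   to 1. *)
move=> A1; have := mulmx_base A.
move: (col_base A) (row_base A); rewrite A1 => C B <-.
by exists (C^~ 0), (B 0) => i j; rewrite mxE big_ord1.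
Qed.

Lemma bilinear2_rank1 n (A : tensor2 R n) : bilinear2 A ->
  \rank (form_mx A) = 1%N ->
  exists phi psi : 'rV[R]_n -> R, [/\ linear_form phi, linear_form psi &
    forall u v, A u v = phi u * psi v].
Proof.
move=> AL /rank1_outer[x [y Axy]].
exists (fun u => \sum_i u 0 i * x i), (fun u => \sum_i u 0 i * y i); split.
- move=> a u v; rewrite mulr_sumr -big_split /=; apply: eq_bigr => i _.
  by rewrite !mxE mulrDl mulrA.
- move=> a u v; rewrite mulr_sumr -big_split /=; apply: eq_bigr => i _.
  by rewrite !mxE mulrDl mulrA.
move=> u v; rewrite (linear_formE (bilinear2l AL v)) mulr_suml.
apply: eq_bigr => i _; rewrite -mulrA; congr (_ * _).
rewrite (linear_formE (bilinear2r AL _)) mulr_sumr.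
by apply: eq_bigr => j _; have := Axy i j; rewrite mxE => ->; ring.
Qed.

End RankOne.

(** The properties of [data_at] from which the pointwise identities follow. They are established
    below for a metric in a chart and, by explicit formulas, for the Goedel metric. *)
Record algebraic_curvature (R : realType) (n : nat) (D : point_data R n) : Prop :=
  AlgebraicCurvature {
    acurv_sym : (gmx D)^T = gmx D;
    acurv_unit : gmx D \in unitmx;
    acurv1 : forall a u u' v w,
      curv D (a *: u + u') v w = a *: curv D u v w + curv D u' v w;
    acurv2 : forall a u v v' w,
      curv D u (a *: v + v') w = a *: curv D u v w + curv D u v' w;
    acurv3 : forall a u v w w',
      curv D u v (a *: w + w') = a *: curv D u v w + curv D u v w';
    acurv_ricci : forall X Y, ricci D X Y = ricci D Y X }.

Lemma traceE (R : realType) n (f : 'rV[R]_n -> 'rV[R]_n) :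
  trace f = \sum_i f (delta_mx 0 i) 0 i.
Proof. by apply: eq_bigr => i _; rewrite /lin1_mx mxE. Qed.

(** * The identities (i) to (iv) at a point *)

Section AlgebraicCurvature.
Variables (R : realType) (n : nat) (D : point_data R n).
Hypothesis n4 : (4 <= n)%N.
Hypothesis DC : algebraic_curvature D.
Local Notation g := (metric D).
Local Notation S := (ricci D).
Local Notation S2 := (ricci2 D).

Lemma riem_multilinear : multilinear4 (riem D).
Proof.
have [gl gr] := form_bilinear (gmx D).
split=> *; move=> a u v; rewrite /riem.
- by rewrite (acurv1 DC) [LHS](gl _ a).
- by rewrite (acurv2 DC) [LHS](gl _ a).
- by rewrite (acurv3 DC) [LHS](gl _ a).
- exact: gr.
Qed.

Lemma ricci_bilinear : bilinear2 S.
Proof.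
split=> u a v w; rewrite /ricci !traceE mulr_sumr -big_split /=.
  by apply: eq_bigr => i _; rewrite (acurv2 DC) !mxE.
by apply: eq_bigr => i _; rewrite (acurv3 DC) !mxE.
Qed.

Let n2 : n%:R - 2 != 0 :> R.
Proof. by rewrite subr_eq0 eqr_nat; case: n n4 => [|[|[|]]]. Qed.

Let n1 : n%:R - 1 != 0 :> R.
Proof. by rewrite subr_eq0 (eqr_nat R n 1); case: n n4 => [|[|[|]]]. Qed.

Let gs := acurv_sym DC.
Let gu := acurv_unit DC.
Let Ss := acurv_ricci DC.
Let SL := ricci_bilinear.
Let RL := riem_multilinear.

Lemma dot_weyl_riem_sum :
  dot D (weyl D) (riem D) + dot D (riem D) (weyl D) =
  dot D (riem D) (riem D) + dot D (weyl D) (weyl D)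
  - ((n%:R - 2) ^+ 2)^-1 *:
    Q (metric D) (- (scal D / (n%:R - 1)) *: wedge (metric D) (ricci D)
                  + wedge (metric D) (ricci2 D)).
Proof.
set W := _ *: wedge g S + wedge g S2.
apply: tensor6P => X1 X2 X3 X4 X Y; rewrite !fctE dot_sum //; congr (_ - _).
rewrite [Q g W _ _ _ _ _ _](@derivation_action_linr _ _ _
  (- (scal D / (n%:R - 1))) 1 (wedge g S) (wedge g S2)) -!/(Q _ _).
  by rewrite /GRing.scale /=; field; rewrite n2 n1.
by move=> *; rewrite mul1r.
Qed.

Section CurvatureConditions.
Variable L : R.
Hypothesis RR :
  dot D (riem D) (riem D) - Q (ricci D) (riem D) = L *: Q (metric D) (weyl D).

Lemma dot_weyl_riem_sum_Q :
  dot D (weyl D) (riem D) + dot D (riem D) (weyl D) =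
  Q (ricci D) (weyl D) + L *: Q (metric D) (weyl D)
  + dot D (weyl D) (weyl D)
  - ((n%:R - 2) ^+ 2)^-1 *:
    Q (metric D) (((n%:R - 2) / 2) *: wedge (ricci D) (ricci D)
                  - scal D *: wedge (metric D) (ricci D)
                  + wedge (metric D) (ricci2 D)).
Proof.
set W := _ + wedge g S2.
apply: tensor6P => X1 X2 X3 X4 X Y; rewrite !fctE dot_sum //.
have := congr1 (fun T : tensor6 R n => T X1 X2 X3 X4 X Y) RR; rewrite /= !fctE.
move/eqP; rewrite subr_eq => /eqP ->.
(* Since R = C + K with K the [schouten_wedge], Q(S, R) = Q(S, C) + Q(S, K). *)
rewrite [Q S (riem D) _ _ _ _ _ _](_ : _ = Q S (weyl D) X1 X2 X3 X4 X Y
   + Q S (schouten_wedge D) X1 X2 X3 X4 X Y); last first.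
  rewrite [Q S (weyl D) _ _ _ _ _ _](derivation_action_linr _ (@weylE _ _ D)).
  by rewrite -!/(Q _ _); ring.
rewrite [Q S (schouten_wedge D) _ _ _ _ _ _](derivation_action_linr _
  (fun _ _ _ _ => erefl)) -!/(Q _ _).
rewrite Q_ricci_metric_metric // Q_ricci_metric_ricci //.
rewrite [Q g W _ _ _ _ _ _](@derivation_action_linr _ _ _ 1 1
  (((n%:R - 2) / 2) *: wedge S S - scal D *: wedge g S) (wedge g S2)); last first.
  by move=> *; rewrite !mul1r.
rewrite [derivation_action _ (_ - _) _ _ _ _ _ _](@derivation_action_linr _ _ _
  ((n%:R - 2) / 2) (- scal D) (wedge S S) (wedge g S)); last first.
  by move=> *; rewrite !fctE mulNr.
(* With p = 1 / (n - 2) and q = kappa / (2 (n - 1) (n - 2)), the coefficient of Q(g, g ^ S) is 2 q +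
   2 p q = kappa / (n - 2)^2, and that of Q(g, S ^ S) is - p / 2. *)
by rewrite -!/(Q _ _) /GRing.scale /=; field; rewrite n2 n1.
Qed.

Variable LC : R.
Hypothesis CC : dot D (weyl D) (weyl D) = LC *: Q (metric D) (weyl D).

Lemma dot_weyl_riem_sum_QQ :
  dot D (weyl D) (riem D) + dot D (riem D) (weyl D) =
  Q (ricci D) (weyl D) + (L + LC) *: Q (metric D) (weyl D)
  - ((n%:R - 2) ^+ 2)^-1 *:
    Q (metric D) (((n%:R - 2) / 2) *: wedge (ricci D) (ricci D)
                  - scal D *: wedge (metric D) (ricci D)
                  + wedge (metric D) (ricci2 D)).
Proof.
rewrite dot_weyl_riem_sum_Q; apply: tensor6P => X1 X2 X3 X4 X Y.
have := congr1 (fun T : tensor6 R n => T X1 X2 X3 X4 X Y) CC.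
rewrite /= !fctE => ->; congr (_ - _).
by rewrite /GRing.scale /=; ring.
Qed.

Variable alpha : R.
Hypothesis S1 : \rank (form_mx (ricci D - alpha *: metric D)) = 1%N.

(** Write S = alpha g + T with T of rank 1. Then T ^ T = 0, and the coefficient (n - 2) alpha -
    kappa + (2 alpha + tr T) of g ^ T vanishes because kappa = n alpha + tr T. *)
Lemma wedge_rank1_metric X1 X2 X3 X4 :
  (((n%:R - 2) / 2) *: wedge S S - scal D *: wedge g S + wedge g S2) X1 X2 X3 X4
  = ((n%:R - 2) / 2 * alpha ^+ 2 - scal D * alpha + alpha ^+ 2)
    * wedge g g X1 X2 X3 X4.
Proof.
have [gl gr] := form_bilinear (gmx D).
have TL : bilinear2 (S - alpha *: g).
  case: SL => Sl Sr; split=> u a v w; rewrite !fctE /GRing.scale /=.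
    by rewrite (Sl u a) [g (_ + _) _](gl u a) /metric; ring.
  by rewrite (Sr u a) [g _ (_ + _)](gr u a) /metric; ring.
have [phi [psi [phiL psiL TE]]] := bilinear2_rank1 TL S1.
have SE X Y : S X Y = alpha * g X Y + phi X * psi Y.
  by rewrite -TE !fctE /GRing.scale /=; ring.
(* The vector dual to [psi]; [phi z] is the trace of phi psi with respect to g. *)
pose z := sharp (gmx D) psi.
have gz X : g z X = psi X by rewrite /metric sharpK.
have opE X : ricci_op D X = alpha *: X + phi X *: z.
  rewrite /ricci_op (@sharp_linear _ _ _ alpha (phi X) (g X) psi) /metric ?sharp_form //.
have S2E X Y : S2 X Y =
    alpha ^+ 2 * g X Y + (2 * alpha + phi z) * (phi X * psi Y).
  rewrite /ricci2 opE (bilinear2l SL) (linear_formZ (bilinear2l SL Y)) !SE gz.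
  ring.
have kE : scal D = n%:R * alpha + phi z.
  rewrite /scal traceE (eq_bigr (fun i => alpha + phi (delta_mx 0 i) * z 0 i)).
    rewrite big_split /= sumr_const card_ord mulr_natl; congr (_ + _).
    by rewrite (linear_formE phiL z); apply: eq_bigr => i _; rewrite mulrC.
  by move=> i _; rewrite opE !mxE !eqxx mulr1.
by rewrite !fctE /GRing.scale /= /wedge !SE !S2E kE; field.
Qed.

Lemma dot_weyl_riem_sum_rank1 :
  dot D (weyl D) (riem D) + dot D (riem D) (weyl D) =
  Q (ricci D) (weyl D) + (L + LC) *: Q (metric D) (weyl D).
Proof.
rewrite dot_weyl_riem_sum_QQ; set W := _ + wedge g S2.
apply: tensor6P => X1 X2 X3 X4 X Y; rewrite !fctE.
(* A second term with coefficient 0 gives the single multiple of g ^ g the binary form required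
   here. *)
rewrite [Q g W _ _ _ _ _ _](@derivation_action_linr _ _ _
  ((n%:R - 2) / 2 * alpha ^+ 2 - scal D * alpha + alpha ^+ 2) 0
  (wedge g g) (wedge g g)); last first.
  by move=> *; rewrite mul0r addr0; exact: wedge_rank1_metric.
by rewrite -!/(Q _ _) Q_metric_metric // mul0r mulr0 addr0 scaler0 subr0.
Qed.

End CurvatureConditions.

End AlgebraicCurvature.

(** * A metric split by two 1-forms *)

Section SplitCurvature.
Variables (R : realType) (D : point_data R 4) (k : R).
Local Notation V := 'rV[R]_4.
Variables (w z : V -> R) (W Z : V).
Hypothesis DC : algebraic_curvature D.
Local Notation g := (metric D).
Hypothesis gW : forall X, g W X = w X.
Hypothesis gZ : forall X, g Z X = z X.
Hypotheses (wW : w W = 1) (zZ : z Z = -1) (zW : z W = 0).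

(** The metric on the orthogonal complement of [W] and [Z], extended by 0: both vectors lie in the
    kernel of [h], by [hW] and [hZ]. *)
Let h : tensor2 R 4 := fun X Y => g X Y - w X * w Y + z X * z Y.
Let ww : tensor2 R 4 := fun X Y => w X * w Y.

Hypothesis ricE : forall X Y, ricci D X Y = k * (w X * w Y).
Hypothesis riemE : forall X1 X2 X3 X4, riem D X1 X2 X3 X4 =
  k / 2 * wedge h ww X1 X2 X3 X4 - k / 4 * wedge h h X1 X2 X3 X4.

Let gs := acurv_sym DC.
Let gu := acurv_unit DC.
Let Ss := acurv_ricci DC.
Let SL := ricci_bilinear DC.
Let RL := riem_multilinear DC.
Let gL : bilinear2 g. Proof. exact: form_bilinear. Qed.
Let gC X Y : g X Y = g Y X. Proof. exact: form_sym. Qed.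
Let hC X Y : h X Y = h Y X. Proof. by rewrite /h gC; ring. Qed.

Let wZ : w Z = 0. Proof. by rewrite -gW gC gZ. Qed.
Let wL : linear_form w.
Proof. by move=> a u v; rewrite -!gW (bilinear2r gL). Qed.
Let gE X Y : g X Y = h X Y + w X * w Y - z X * z Y.
Proof. by rewrite /h; ring. Qed.

Let hW X : h X W = 0.
Proof. by rewrite /h gC gW wW zW; ring. Qed.

Let hZ X : h X Z = 0.
Proof. by rewrite /h gC gZ zZ wZ; ring. Qed.

(** R and C are expressed through h, w and z, so these three components of a vector
    [sharp (gmx D) (T X Y U)] suffice to evaluate the derivation terms. *)
Let sharpE (T : tensor4 R 4) (X Y U A : V) : multilinear4 T ->
  [/\ h (sharp (gmx D) (T X Y U)) A =
        T X Y U A - T X Y U W * w A + T X Y U Z * z A,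
     w (sharp (gmx D) (T X Y U)) = T X Y U W &
     z (sharp (gmx D) (T X Y U)) = T X Y U Z].
Proof.
move=> [_ _ _ T4]; have gT B : g (sharp (gmx D) (T X Y U)) B = T X Y U B.
  by rewrite /metric sharpK //; exact: T4.
by rewrite /h -gW -gZ !(gC W) !(gC Z) !gT.
Qed.

Lemma split_ricci_op X : ricci_op D X = (k * w X) *: W.
Proof.
rewrite /ricci_op (@sharp_linear _ _ _ (k * w X) 0 (g W) (g W)).
  by rewrite sharp_form // scale0r addr0.
by move=> U; rewrite gW ricE; ring.
Qed.

Lemma split_scal : scal D = k.
Proof.
rewrite /scal traceE -[RHS]mulr1 -wW (linear_formE wL W) mulr_sumr.
by apply: eq_bigr => i _; rewrite split_ricci_op mxE; ring.
Qed.

Lemma split_weylE X1 X2 X3 X4 : weyl D X1 X2 X3 X4 =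
  k / 6 * (- wedge h h X1 X2 X3 X4 + wedge h ww X1 X2 X3 X4
    - wedge h (fun X Y => z X * z Y) X1 X2 X3 X4
    + 2 * wedge ww (fun X Y => z X * z Y) X1 X2 X3 X4).
Proof.
rewrite /weyl !fctE /GRing.scale /= /GRing.scale /= riemE split_scal.
by rewrite /wedge !ricE !gE /ww; field.
Qed.

(** Stated as L Q(g, C) with L = 0, the form in which (iii) takes it. *)
Lemma split_riem_riem : dot D (riem D) (riem D) - Q (ricci D) (riem D) = 0 *: Q g (weyl D).
Proof.
apply: tensor6P => X1 X2 X3 X4 X Y; rewrite !fctE scale0r QE // /dot /derivation_action.
have RE U A := sharpE X Y U A RL.
rewrite !riemE /wedge /ww.
rewrite !(hC _ (sharp _ _)).
have hE U A : h (sharp (gmx D) (riem D X Y U)) A =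
    k / 2 * (w Y * w U * h X A - w X * w U * h Y A)
    - k / 2 * (h Y U * h X A - h X U * h Y A).
  by have [-> _ _] := RE U A; rewrite !riemE /wedge /ww !hW !hZ wW wZ; field.
have wE U : w (sharp (gmx D) (riem D X Y U)) =
    k / 2 * (h Y U * w X - h X U * w Y).
  (* The w-component does not depend on the vector [A] of [sharpE], for which [0] is taken. *)
  by have [_ -> _] := RE U 0; rewrite !riemE /wedge /ww !hW wW; field.
rewrite !hE !wE !ricE.
rewrite ?(hC X X1, hC X X2, hC X X3, hC X X4, hC Y X1, hC Y X2, hC Y X3, hC Y X4).
rewrite ?(hC X2 X1, hC X3 X1, hC X4 X1, hC X3 X2, hC X4 X2, hC X4 X3).
by field.
Qed.

Lemma split_weyl_weyl : dot D (weyl D) (weyl D) = (k / 6) *: Q g (weyl D).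
Proof.
have CL := weyl_multilinear RL SL.
apply: tensor6P => X1 X2 X3 X4 X Y; rewrite !fctE /GRing.scale /= QE // /dot /derivation_action.
have RE U A := sharpE X Y U A CL.
rewrite !split_weylE /wedge /ww.
rewrite !(hC _ (sharp _ _)).
have hE U A : h (sharp (gmx D) (weyl D X Y U)) A = k / 6 * (
    (w Y * w U - z Y * z U) * h X A - (w X * w U - z X * z U) * h Y A
    - 2 * (h Y U * h X A - h X U * h Y A)).
  by have [-> _ _] := RE U A; rewrite !split_weylE /wedge /ww !hW !hZ wW wZ zW zZ; field.
have wE U : w (sharp (gmx D) (weyl D X Y U)) =
    k / 6 * (h Y U * w X - h X U * w Y + 2 * (w X * z Y * z U - w Y * z X * z U)).
  by have [_ -> _] := RE U 0; rewrite !split_weylE /wedge /ww !hW wW zW; field.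
(* C involves z as well as h and w, so the third component enters here. *)
have zE U : z (sharp (gmx D) (weyl D X Y U)) =
    k / 6 * (h Y U * z X - h X U * z Y + 2 * (w X * z Y * w U - w Y * z X * w U)).
  by have [_ _ ->] := RE U 0; rewrite !split_weylE /wedge /ww !hZ wZ zZ; field.
rewrite !hE !wE !zE !gE.
rewrite ?(hC X X1, hC X X2, hC X X3, hC X X4, hC Y X1, hC Y X2, hC Y X3, hC Y X4).
rewrite ?(hC X2 X1, hC X3 X1, hC X4 X1, hC X3 X2, hC X4 X2, hC X4 X3).
by field.
Qed.

Lemma split_dot_weyl_riem_sum :
  dot D (weyl D) (riem D) + dot D (riem D) (weyl D) =
  Q (ricci D) (weyl D) + (scal D / 6) *: Q (metric D) (weyl D).
Proof.
rewrite (dot_weyl_riem_sum_QQ _ DC split_riem_riem split_weyl_weyl) //.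
set U := _ + wedge _ (ricci2 D).
(* S has rank at most 1, so S ^ S = 0; and S2 = k S with kappa = k, so the other two terms
   cancel. *)
have UE X1 X2 X3 X4 : U X1 X2 X3 X4 = 0.
  rewrite /U !fctE /GRing.scale /= /GRing.scale /= /wedge /ricci2 !ricE.
  by rewrite split_scal !split_ricci_op !(linear_formZ wL) wW; field.
apply: tensor6P => X1 X2 X3 X4 X Y; rewrite !fctE add0r split_scal.
by rewrite [Q g U _ _ _ _ _ _](_ : _ = 0) ?scaler0 ?subr0 // /Q /derivation_action !UE !addr0 oppr0.
Qed.

End SplitCurvature.

(** * The curvature of constant fields in terms of the Christoffel symbols *)

Section CoordinateCurvature.
Variables (R : realType) (n : nat).
Local Notation V := 'rV[R]_n.
Implicit Types (g : V -> 'M[R]_n) (x u v w : V).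

Lemma form_delta (h : 'M[R]_n) i j : form h (delta_mx 0 i) (delta_mx 0 j) = h i j.
Proof. by rewrite /form -rowE trmx_delta -colE !mxE. Qed.

Lemma unitmx_form (h : 'M[R]_n) :
  (forall u, (forall v, form h u v = 0) -> u = 0) -> h \in unitmx.
Proof.
move=> h0; rewrite -row_free_unit -kermx_eq0; apply/rowV0P => u /sub_kermxP uh.
by apply: h0 => v; rewrite /form uh mul0mx mxE.
Qed.

Lemma is_derive_row x v (f : V -> V) (df : V) :
  (forall i, is_derive x v (fun y => f y 0 i) (df 0 i)) -> is_derive x v f df.
Proof.
move=> fi; have dfx : derivable f x v.
  by apply/derivable_mxP => i j; rewrite ord1; have [] := fi j.
apply: DeriveDef => //; apply/rowP => j; rewrite derive_mx // mxE.
by have [_ ->] := fi j.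
Qed.

Lemma nabla_cst g v w x : nabla g (cst v) (cst w) x = christoffel g x v w.
Proof. by rewrite /nabla derive_cst add0r. Qed.

Lemma curvature_cst g u v w x :
  curvature g (cst u) (cst v) (cst w) x =
  'D_u (fun y => christoffel g y v w) x + christoffel g x u (christoffel g x v w)
  - ('D_v (fun y => christoffel g y u w) x
     + christoffel g x v (christoffel g x u w)).
Proof.
have nE u' w' : nabla g (cst u') (cst w') = fun y => christoffel g y u' w'.
  by apply/funext => y; exact: nabla_cst.
rewrite /curvature !nE.
have fE (f1 f2 f3 : V -> V) : (f1 - f2 - f3) x = f1 x - f2 x - f3 x by [].
(* Constant fields commute, so the last term of the curvature is a covariant derivative along 0. *)
rewrite fE /nabla [bracket _ _ x](_ : _ = 0); last first.
  by rewrite /bracket !derive_cst subr0.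
rewrite derive0 add0r [christoffel g x 0 w](_ : _ = 0) ?subr0 //.
rewrite /christoffel /sharp (_ : \row_i _ = 0) ?mul0mx //.
apply/rowP => i; rewrite !mxE derive0 add0r.
have f0 (v' w' : V) : v' = 0 -> (fun y => form (g y) v' w') = cst 0.
  by move=> ->; apply/funext => y; rewrite /form !mul0mx mxE.
by rewrite !f0 // !derive_cst subr0 mulr0.
Qed.

End CoordinateCurvature.

(** * The Goedel spacetime *)

Section Goedel.
Variables (R : realType) (a : R).
Hypothesis a0 : 0 < a.
Local Notation V := 'rV[R]_4.
Local Notation gg := (goedel_metric a).

(** The cases are the numerals 0 to 3 of ['I_4], by which components are indexed, instead of bare
    [Ordinal] terms. *)
Lemma ord4P (P : 'I_4 -> Prop) : P 0 -> P 1 -> P 2 -> P 3 -> forall i, P i.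
Proof.
move=> P0 P1 P2 P3 [[|[|[|[|//]]]] i4].
- by rewrite (_ : Ordinal _ = 0) //; exact: val_inj.
- by rewrite (_ : Ordinal _ = 1) //; exact: val_inj.
- by rewrite (_ : Ordinal _ = 2) //; exact: val_inj.
- by rewrite (_ : Ordinal _ = 3) //; exact: val_inj.
Qed.

Lemma form_sq n (u v w : 'rV[R]_n) :
  form (w^T *m w) u v = (u *m w^T) 0 0 * (v *m w^T) 0 0.
Proof.
rewrite /form !mulmxA -mulmxA mxE big_ord1; congr (_ * _).
by rewrite -[w *m _]trmxK trmx_mul trmxK mxE.
Qed.

Lemma formNm n (A : 'M[R]_n) u v : form (- A) u v = - form A u v.
Proof. by rewrite -scaleN1r formZm mulN1r. Qed.

Lemma goedel_formE x u v : form (gg x) u v = a ^+ 2 *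
  ((u 0 0 + expR (x 0 1) * u 0 2) * (v 0 0 + expR (x 0 1) * v 0 2)
   - u 0 1 * v 0 1 - 2^-1 * expR (x 0 1) ^+ 2 * (u 0 2 * v 0 2) - u 0 3 * v 0 3).
Proof.
rewrite /goedel_metric formZm !formDm !formNm formZm !form_sq.
have dxE (w : V) i : (w *m (dx R i)^T) 0 0 = w 0 i.
  by rewrite /dx trmx_delta -colE mxE.
have wE (w : V) : (w *m (dx R 0 + expR (x 0 1) *: dx R 2)^T) 0 0 =
    w 0 0 + expR (x 0 1) * w 0 2.
  by rewrite linearD linearZ mulmxDr -scalemxAr mxE dxE mxE dxE.
rewrite !wE !dxE (_ : 2 * x 0 1 = x 0 1 + x 0 1) ?expRD; last by ring.
by ring.
Qed.

Lemma is_derive_coord_comp n (i : 'I_n) (F : R -> R) (x v : 'rV[R]_n) d :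
  is_derive (x 0 i) 1 F d ->
  is_derive x v (fun y => F (y 0 i)) (v 0 i * d).
Proof.
move=> [dF Fd].
have dc : differentiable (fun y : 'rV[R]_n => y 0 i) x by exact: differentiable_coord.
have de : differentiable F (x 0 i) by apply/derivable1_diffP.
have dce : differentiable (fun y : 'rV[R]_n => F (y 0 i)) x.
  exact: differentiable_comp.
apply: DeriveDef; first exact: diff_derivable.
have cL : linear (fun y : 'rV[R]_n => y 0 i) by move=> a' u u'; rewrite !mxE.
rewrite deriveE // (_ : (fun y => _) = F \o (fun y : 'rV[R]_n => y 0 i)) //.
rewrite diff_comp // deriv1E // derive1E Fd /= -deriveE //.
rewrite (_ : 'D_v _ x = v 0 i) //.
apply: cvg_lim => //.
(* The difference quotient of the i-th coordinate along [v] is [v 0 i] for every nonzero [t]. *)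
apply: (@cvg_trans _ ((cst (v 0 i)) @ 0^')).
  apply: near_eq_cvg; near=> t => /=.
  by rewrite !mxE addrK /GRing.scale /= mulKf //; near: t; exact: nbhs_dnbhs_neq.
exact: cvg_cst.
Unshelve. all: by end_near. Qed.

(** The components of the Goedel metric and its Christoffel symbols are all functions of x^1 of this
    shape. *)
Lemma is_derive_exp_poly (A B C E t : R) :
  is_derive t 1 (fun t => A + B * expR t + C * expR t ^+ 2 + E * expR (- t))
    (B * expR t + 2 * C * expR t ^+ 2 - E * expR (- t)).
Proof.
have eD := is_derive_expR t.
have eND : is_derive t (1 : R) (fun t => expR (- t)) (expR (- t) * -1).
  exact: (@is_derive1_comp _ expR -%R).
have -> : (fun t => A + B * expR t + C * expR t ^+ 2 + E * expR (- t)) =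
    cst A + B *: @expR R + C *: @expR R ^+ 2 + E *: (fun t => expR (- t)).
  by apply/funext.
have := (is_deriveD (is_deriveD (is_deriveD (is_derive_cst A t 1)
  (is_deriveZ B eD)) (is_deriveZ C (is_deriveX 2 eD))) (is_deriveZ E eND)).

by move=> dF; apply: (is_derive_eq dF); rewrite /GRing.scale /= expr1; ring.
Qed.

Let is_derive_form x u v w : is_derive x u (fun y => form (gg y) v w)
  (a ^+ 2 * (u 0 1 * expR (x 0 1))
   * (v 0 0 * w 0 2 + v 0 2 * w 0 0 + expR (x 0 1) * (v 0 2 * w 0 2))).
Proof.
have := is_derive_coord_comp u (is_derive_exp_poly
  (a ^+ 2 * (v 0 0 * w 0 0 - v 0 1 * w 0 1 - v 0 3 * w 0 3))
  (a ^+ 2 * (v 0 0 * w 0 2 + v 0 2 * w 0 0)) (a ^+ 2 * (2^-1 * v 0 2 * w 0 2)) 0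
  (x 0 1)).
set F := (fun y => _) => dF.
have -> : (fun y => form (gg y) v w) = F.
  by apply/funext => y; rewrite goedel_formE /F; field.
by apply: is_derive_eq; field.

Qed.

Definition goedel_christoffel (x u v : V) : V :=
  let e := expR (x 0 1) in
  \row_i [:: u 0 0 * v 0 1 + u 0 1 * v 0 0 + e / 2 * (u 0 1 * v 0 2 + u 0 2 * v 0 1);
    e / 2 * (u 0 0 * v 0 2 + u 0 2 * v 0 0) + e ^+ 2 / 2 * (u 0 2 * v 0 2);
    - expR (- x 0 1) * (u 0 0 * v 0 1 + u 0 1 * v 0 0);
    0]`_i.

Let expRV (t : R) : expR (- t) = (expR t)^-1. Proof. exact: expRN. Qed.

Let aN0 : a != 0. Proof. by rewrite gt_eqF. Qed.

Let e_neq0 (t : R) : expR t != 0. Proof. by rewrite gt_eqF ?expR_gt0. Qed.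

Lemma goedel_metric_unit x : gg x \in unitmx.
Proof.
apply: unitmx_form => u u0; pose e := expR (x 0 1).
have a2 : a ^+ 2 != 0 by rewrite expf_neq0.
have uE (v : V) : (u 0 0 + e * u 0 2) * (v 0 0 + e * v 0 2) - u 0 1 * v 0 1
    - 2^-1 * e ^+ 2 * (u 0 2 * v 0 2) - u 0 3 * v 0 3 = 0.
  by apply: (mulfI a2); rewrite mulr0 -(u0 v) goedel_formE.
(* A vector [u] in the kernel is paired with each basis vector in turn; index 2 comes last, when the
   other terms are known to vanish. *)
have u1 : u 0 1 = 0 by have := uE (delta_mx 0 1); rewrite !mxE /=; lra.
have u3 : u 0 3 = 0 by have := uE (delta_mx 0 3); rewrite !mxE /=; lra.
have ue : u 0 0 + e * u 0 2 = 0 by have := uE (delta_mx 0 0); rewrite !mxE /=; lra.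
have u2 : u 0 2 = 0.
  have := uE (delta_mx 0 2); rewrite ue u1 u3 mul0r !mul0r !subr0 sub0r !mxE /= mulr1.
  move/eqP; rewrite oppr_eq0 mulf_eq0 mulf_eq0 invr_eq0 pnatr_eq0 expf_eq0 /=.
  by rewrite (negPf (e_neq0 _)) /= => /eqP.
apply/rowP; elim/ord4P; rewrite [RHS]mxE // -ue u2; ring.
Qed.

Lemma goedel_metric_sym x : (gg x)^T = gg x.
Proof.
apply/matrixP => i j; rewrite mxE -!form_delta !goedel_formE; ring.
Qed.

Lemma goedel_christoffelE x u v :
  christoffel gg x u v = goedel_christoffel x u v.
Proof.
(* The right-hand side is written as [sharp] of its own dual form, so that two forms are compared
   and the metric need not be inverted. *)
rewrite /christoffel -[RHS](sharp_form _ (goedel_metric_unit x)).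
congr (sharp _ _); apply/funext => w.
have [_ ->] := is_derive_form x u v w.
have [_ ->] := is_derive_form x v u w.
have [_ ->] := is_derive_form x w u v.
by rewrite goedel_formE !mxE /= expRV; field.
Qed.

Let k := a ^- 2.

(* The factor [a ^- 2] of the curvature is cancelled by the factors [a] of the
   forms [w], [h], which are absent from [om] and [h] here. *)
Definition goedel_curvature (x u v w : V) : V :=
  let e := expR (x 0 1) in
  let om (X : V) := X 0 0 + e * X 0 2 in
  let h (X Y : V) := - (X 0 1 * Y 0 1 + e ^+ 2 / 2 * (X 0 2 * Y 0 2)) in
  let pi (X : V) : V := \row_i [:: - e * X 0 2; X 0 1; X 0 2; 0]`_i in
  2^-1 *: (om v * om w *: pi u - om u * om w *: pi v
    + (h v w * om u - h u w * om v) *: dx R 0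
    - h v w *: pi u + h u w *: pi v).

Lemma goedel_curvatureE x u v w :
  curvature gg (cst u) (cst v) (cst w) x = goedel_curvature x u v w.
Proof.
rewrite curvature_cst.
have cE (s t : V) : (fun y => christoffel gg y s t) = fun y => goedel_christoffel y s t.
  by apply/funext => y; exact: goedel_christoffelE.
rewrite !cE !goedel_christoffelE.
(* The symbols depend on x^1 alone, whence the factor [r 0 1]. Below, [dF] receives their
   coefficients on 1, e, e^2 and 1/e, with e = exp(x^1). *)
have dE (r s t : V) : 'D_r (fun y => goedel_christoffel y s t) x = r 0 1 *: \row_i
  [:: expR (x 0 1) / 2 * (s 0 1 * t 0 2 + s 0 2 * t 0 1);
    expR (x 0 1) / 2 * (s 0 0 * t 0 2 + s 0 2 * t 0 0)
    + expR (x 0 1) ^+ 2 * (s 0 2 * t 0 2);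
    expR (- x 0 1) * (s 0 0 * t 0 1 + s 0 1 * t 0 0); 0]`_i.
  have dF A B C E := is_derive_coord_comp r (is_derive_exp_poly A B C E (x 0 1)).
  suff [] : is_derive x r (fun y => goedel_christoffel y s t) (r 0 1 *: \row_i
  [:: expR (x 0 1) / 2 * (s 0 1 * t 0 2 + s 0 2 * t 0 1);
    expR (x 0 1) / 2 * (s 0 0 * t 0 2 + s 0 2 * t 0 0)
    + expR (x 0 1) ^+ 2 * (s 0 2 * t 0 2);
    expR (- x 0 1) * (s 0 0 * t 0 1 + s 0 1 * t 0 0); 0]`_i) by [].
  apply: is_derive_row; elim/ord4P; rewrite !mxE /=.
  - have := dF (s 0 0 * t 0 1 + s 0 1 * t 0 0) (2^-1 * (s 0 1 * t 0 2 + s 0 2 * t 0 1)) 0 0.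
    set F := (fun y => _) => FD; rewrite (_ : (fun y => _) = F).
      by apply: (is_derive_eq FD); field.
    by apply/funext => y; rewrite /F mxE /=; field.
  - have := dF 0 (2^-1 * (s 0 0 * t 0 2 + s 0 2 * t 0 0)) (2^-1 * (s 0 2 * t 0 2)) 0.
    set F := (fun y => _) => FD; rewrite (_ : (fun y => _) = F).
      by apply: (is_derive_eq FD); field.
    by apply/funext => y; rewrite /F mxE /=; field.
  - have := dF 0 0 0 (- (s 0 0 * t 0 1 + s 0 1 * t 0 0)).
    set F := (fun y => _) => FD; rewrite (_ : (fun y => _) = F).
      by apply: (is_derive_eq FD); field.
    by apply/funext => y; rewrite /F mxE /=; field.
  - have := dF 0 0 0 0.
    set F := (fun y => _) => FD; rewrite (_ : (fun y => _) = F).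
      by apply: (is_derive_eq FD); field.
    by apply/funext => y; rewrite /F mxE /=; field.
by rewrite !dE; apply/rowP; elim/ord4P; rewrite !mxE /= ?expRV; field; rewrite ?e_neq0.
Qed.


Let om (x : V) (X : V) : R := a * (X 0 0 + expR (x 0 1) * X 0 2).

Lemma goedel_ricci x X Y :
  ricci (data_at gg x) X Y = a ^- 2 * (om x X * om x Y).
Proof.
rewrite /ricci traceE.
rewrite (eq_bigr (fun i => goedel_curvature x (delta_mx 0 i) X Y 0 i)); last first.
  by move=> i _; rewrite -goedel_curvatureE.
by rewrite !big_ord_recl big_ord0 /om !mxE /=; field.
Qed.

Lemma goedel_algebraic_curvature x : algebraic_curvature (data_at gg x).
Proof.
split=> [||c u u' v w|c u v v' w|c u v w w'|X Y] /=.
- exact: goedel_metric_sym.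
- exact: goedel_metric_unit.
- by rewrite !goedel_curvatureE; apply/rowP; elim/ord4P; rewrite !mxE /=; field.
- by rewrite !goedel_curvatureE; apply/rowP; elim/ord4P; rewrite !mxE /=; field.
- by rewrite !goedel_curvatureE; apply/rowP; elim/ord4P; rewrite !mxE /=; field.
- by rewrite !goedel_ricci; ring.
Qed.

Lemma goedel_dot_sum x : let D := data_at gg x in
  dot D (weyl D) (riem D) + dot D (riem D) (weyl D) =
  Q (ricci D) (weyl D) + (scal D / 6) *: Q (metric D) (weyl D).
Proof.
(* The 1-forms are a (dx^0 + e^{x^1} dx^2) and a dx^3. The vectors are their metric duals; the
   second has a minus sign because the metric is - a^2 on the x^3 direction. *)
apply: (@split_dot_weyl_riem_sum _ _ (a ^- 2) (om x) (fun X => a * X 0 3)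
  (a^-1 *: dx R 0) (- a^-1 *: dx R 3)).
- exact: goedel_algebraic_curvature.
- by move=> X; rewrite /metric goedel_formE !mxE /= /om; field.
- by move=> X; rewrite /metric goedel_formE !mxE /= /om; field.
- by rewrite /om !mxE /=; field.
- by rewrite /om !mxE /=; field.
- by rewrite /om !mxE /=; field.
- exact: goedel_ricci.
move=> X1 X2 X3 X4; rewrite /riem /= goedel_curvatureE /wedge /metric /=.
by rewrite !goedel_formE /om !mxE /=; field.
Qed.

End Goedel.

(** * Differential calculus *)

Section LineDerivative.
Variables (R : realType) (V : normedModType R).
Implicit Types (f : V -> R) (x u v : V).

Lemma is_derive_line f x v (t : R) : derivable f (t *: v + x) v ->
  is_derive t 1 (fun s : R => f (s *: v + x)) ('D_v f (t *: v + x)).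
Proof.
have E : (fun h : R => h^-1 *: (((fun s : R => f (s *: v + x)) \o shift t) (h *: 1)
      - f (t *: v + x)))
    = (fun h : R => h^-1 *: ((f \o shift (t *: v + x)) (h *: v) - f (t *: v + x))).
  apply/funext => h /=; congr (_ *: (f _ - _)).
  by rewrite -[h *: 1]/(h * 1) mulr1 scalerDl addrA.
by move=> df; apply: DeriveDef; rewrite /derivable /derive /= E.
Qed.

(** The bound [|s| <= |c|] locates the intermediate parameter for either sign of [c]. *)
Lemma MVT_line f x v (c : R) :
  (forall s : R, `|s| <= `|c| -> derivable f (s *: v + x) v) ->
  exists2 s : R, `|s| <= `|c| & f (c *: v + x) - f x = c * 'D_v f (s *: v + x).
Proof.
move=> df; pose F (s : R) := f (s *: v + x).
have cont (i : interval R) : {in i, forall s, `|s| <= `|c|} ->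
    {within [set` i], continuous F}.
  move=> ic; apply: derivable_within_continuous => s /ic sc.
  by have [] := is_derive_line (df s sc).
have F0 : f x = F 0 by rewrite /F scale0r add0r.
rewrite F0 -/(F c); have [c0|c0] := leP 0 c.
- have le s : s \in `[0, c] -> `|s| <= `|c|.
    by rewrite in_itv /= => /andP[s0 sc]; rewrite !ger0_norm.
  have [s|s /le sc ->] := @MVT_segment _ F (fun s => 'D_v f (s *: v + x)) _ _ c0 _ (cont _ le).
    by move=> /subset_itv_oo_cc/le/df/is_derive_line.
  by exists s => //; rewrite subr0 mulrC.
have le s : s \in `[c, 0] -> `|s| <= `|c|.
  by rewrite in_itv /= => /andP[s0 sc]; rewrite !ler0_norm ?lerN2 // ltW.
have [s|s /le sc E] := @MVT_segment _ F (fun s => 'D_v f (s *: v + x)) _ _ (ltW c0) _ (cont _ le).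
  by move=> /subset_itv_oo_cc/le/df/is_derive_line.
by exists s => //; rewrite -opprB E sub0r mulrN opprK mulrC.
Qed.

End LineDerivative.

(** * Differentiability of functions of class C^1 *)

Section C1.
Variables (R : realType) (n : nat).
Local Notation V := 'rV[R]_n.
Implicit Types (f : V -> R) (x u v : V).

Lemma norm_coord (h : V) i : `|h 0 i| <= `|h|.
Proof.
rewrite [leRHS]/Num.Def.normr /= mx_normrE.
exact: (le_bigmax _ (fun ij => `|h ij.1 ij.2|) (0, i)).
Qed.

Lemma norm_le_coord (h : V) (c : R) : 0 <= c -> (forall i, `|h 0 i| <= c) -> `|h| <= c.
Proof.
move=> c0 hc; rewrite [leLHS]/Num.Def.normr /= mx_normrE.
by apply: bigmax_le => // -[i j] _ /=; rewrite ord1.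
Qed.

Lemma differentiable_linear_form (c : 'I_n -> R) x :
  differentiable (fun h : V => \sum_i h 0 i * c i) x.
Proof.
rewrite (_ : (fun h => _) = \sum_i (c i *: (fun h : V => h 0 i))).
  by apply: differentiable_sum => i; apply: differentiableZ; exact: differentiable_coord.
by apply/funext => h; rewrite fct_sumE; apply: eq_bigr => i _; rewrite mulrC.
Qed.

(* The coordinates are increased one at a time, with the mean value theorem for
   each. *)
Lemma C1_differentiable (U : set V) f : open U -> Ck 1 U f ->
  forall x, U x -> differentiable f x.
Proof.
move=> Uo [_ f1] x Ux; pose L (h : V) := \sum_i h 0 i * 'D_(delta_mx 0 i) f x.
have L_lin : linear L.
  move=> a u v; rewrite /L scaler_sumr -big_split /=; apply: eq_bigr => i _.
  by rewrite !mxE mulrDl -mulrA.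
pose LL : {linear V -> R} := HB.pack L (GRing.isLinear.Build _ _ _ _ _ L_lin).
have L_cont : continuous LL.
  by move=> h; apply: differentiable_continuous; exact: differentiable_linear_form.
have fo : f \o shift x = cst (f x) + (LL : V -> R) +o_ (0 : V) id.
  apply/eqaddoP => e e0.
  (* Each of the n coordinate steps may contribute an error of e / (n + 1) times |h|; the
     denominator is nonzero even for n = 0. *)
  have e'0 : 0 < e / n.+1%:R by rewrite divr_gt0.
  have near_x : \forall y \near x, U y /\
      forall i, `|'D_(delta_mx 0 i) f x - 'D_(delta_mx 0 i) f y| <= e / n.+1%:R.
    near=> y; split; first by near: y; exact: open_nbhs_nbhs.
    near: y; apply: filter_forall => i.
    have [_ [/(_ x Ux) fc _]] := f1 i.
    by move/cvgrPdist_le : fc; apply.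
  have [d /= d0 xd] := (nbhs_ballP _ _).1 near_x.
  have {}xd (h : V) : `|h| < d -> U (h + x) /\
      forall i, `|'D_(delta_mx 0 i) f x - 'D_(delta_mx 0 i) f (h + x)| <= e / n.+1%:R.
    by move=> hd; apply: xd; rewrite -ball_normE /= opprD addrCA subrr addr0 normrN.
  apply/nbhs_ballP; exists d => //= h; rewrite -ball_normE /= sub0r normrN => hd.
  (* [H k] keeps the first k coordinates of [h], so it runs from 0 to [h]. *)
  pose H k : V := \row_j (if (j < k)%N then h 0 j else 0).
  suff : forall k, (k <= n)%N -> `|f (H k + x) - f x - L (H k)| <= k%:R * (e / n.+1%:R * `|h|).
    move/(_ n (leqnn n)); rewrite (_ : H n = h); last first.
      by apply/rowP => j; rewrite mxE ltn_ord.
    rewrite !fctE /= opprD addrA => /le_trans; apply.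
    rewrite mulrA [_ * (e / _)]mulrC ler_wpM2r // -mulrA ler_piMr ?(ltW e0) //.
    by rewrite mulrC ler_pdivrMr // mul1r ler_nat.
  elim=> [_|k IHk kn].
    rewrite (_ : H 0%N = 0) ?add0r; last by apply/rowP => j; rewrite !mxE.
    have -> : L 0 = 0 by exact: (linear0 LL).
    by rewrite subrr sub0r oppr0 normr0 mul0r.
  pose i := Ordinal kn; pose b : V := delta_mx 0 i.
  have HS : H k.+1 = h 0 i *: b + H k.
    apply/rowP => j; rewrite !mxE eqxx /= ltnS leq_eqVlt -val_eqE /=.
    case: (ltngtP j k) => //= jk; rewrite ?mulr0 ?add0r // mulr1 addr0.
    by congr (h 0 _); exact: val_inj.
  (* The norm is the sup norm: a vector whose coordinates are bounded by those of [h] stays in the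
     ball. *)
  have small (s : R) : `|s| <= `|h 0 i| -> `|s *: b + H k| < d.
    move=> sh; apply: le_lt_trans hd; apply: norm_le_coord => // j.
    rewrite !mxE eqxx /= -val_eqE /=; case: (ltngtP j k) => jk /=.
    - by rewrite mulr0 add0r norm_coord.
    - by rewrite mulr0 addr0 normr0.
    - by rewrite mulr1 addr0 (le_trans sh) // norm_coord.
  have [s|s sh E] := @MVT_line _ _ f (H k + x) b (h 0 i).
    move=> /small; rewrite addrA => /xd[Uy _]; have [dy _] := f1 i; exact: dy.
  have Lb : L (h 0 i *: b + H k) = h 0 i * 'D_b f x + L (H k).
    rewrite L_lin; congr (_ * _ + _); rewrite /L (bigD1 i) //= big1 ?addr0.
      by rewrite mxE !eqxx mul1r.
    by move=> j ji; rewrite mxE eqxx /= (negPf ji) mul0r.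
  rewrite HS Lb -[_ + H k + x]addrA -natr1 mulrDl mul1r [leRHS]addrC.
  rewrite (_ : _ - _ - _ = h 0 i * ('D_b f (s *: b + (H k + x)) - 'D_b f x)
    + (f (H k + x) - f x - L (H k))); last by rewrite mulrBr -E; ring.
  rewrite (le_trans (ler_normD _ _)) // lerD ?IHk ?(ltnW kn) //.
  rewrite normrM mulrC ler_pM // ?norm_coord // addrA distrC.
  by have [_] := xd _ (small s sh); apply.
(* The expansion [fo] identifies the differential with [L], and is then itself the criterion of
   [diff_locallyP]. *)
have dfL := diff_unique L_cont fo.
by apply/diff_locallyP; rewrite dfL.
Unshelve. all: by end_near. Qed.

End C1.

(** * Symmetry of second derivatives *)

Section Schwarz.
Variables (R : realType) (n : nat).
Local Notation V := 'rV[R]_n.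
Implicit Types (f : V -> R) (x u v : V).

Lemma is_derive_translate f a x v (d : R) : is_derive (a + x) v f d ->
  is_derive x v (fun y => f (a + y)) d.
Proof.
have E : (fun h : R => h^-1 *: (((fun y => f (a + y)) \o shift x) (h *: v) - f (a + x)))
    = (fun h : R => h^-1 *: ((f \o shift (a + x)) (h *: v) - f (a + x))).
  by apply/funext => h /=; rewrite addrCA.
by case=> df <-; apply: DeriveDef; rewrite /derivable /derive /= E.
Qed.

(** The mean value theorem along u for y -> f(t v + y) - f(y) turns the second difference into t
    times a difference of values of D_u f, which the differentiability of D_u f at [x] evaluates up
    to o(t). *)
Lemma second_difference f x u v :
  (\forall y \near x, differentiable f y) -> differentiable ('D_u f) x ->
  forall e, 0 < e -> \forall t \near (0 : R),
    `|(f (t *: v + (t *: u + x)) - f (t *: u + x) - (f (t *: v + x) - f x))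
      - t * (t * 'D_v ('D_u f) x)| <= `|t| * (`|t| * e).
Proof.
(* The two remainders are of size |t| (|u| + |v|) and |t| |u|, whose sum is at most |t| K; adding 1
   makes [K] positive. *)
move=> df du e e0; pose K := 2 * `|u| + `|v| + 1.
have K0 : 0 < K by rewrite ltr_wpDl // addr_ge0 // mulr_ge0.
have eK : 0 < e / K by rewrite divr_gt0.
have := diff_locally du; move/eqaddoP => /(_ _ eK) duo.
have [d /= d0 xd] := (nbhs_ballP _ _).1 df.
have [d' /= d'0 xd'] := (nbhs_ballP _ _).1 duo.
apply/nbhs_ballP; exists (Num.min d d' / K) => /=.
  by rewrite divr_gt0 // lt_min d0.
move=> t; rewrite -ball_normE /= sub0r normrN ltr_pdivlMr // => tK.
have [td td'] : `|t| * K < d /\ `|t| * K < d' by move: tK; rewrite lt_min => /andP.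
have norm_su (s : R) : `|s| <= `|t| -> `|s *: u| <= `|t| * `|u|.
  by move=> st; rewrite normrZ ler_wpM2r.
have norm_tv (s : R) : `|s| <= `|t| -> `|t *: v + s *: u| <= `|t| * (`|u| + `|v|).
  move=> st; rewrite (le_trans (ler_normD _ _)) // mulrDr addrC lerD ?norm_su //.
  by rewrite normrZ.
have Kuv : `|u| + `|v| <= K.
  by rewrite /K; have := normr_ge0 u; lra.
have Ku : `|u| <= K.
  by rewrite /K; have := normr_ge0 u; have := normr_ge0 v; lra.
have near_f (h : V) : `|h| < d -> differentiable f (h + x).
  by move=> hd; apply: xd; rewrite -ball_normE /= opprD addrCA subrr addr0 normrN.
have near_o (h : V) : `|h| < d' -> `|'D_u f (h + x) - 'D_u f x - 'd ('D_u f) x h| <= e / K * `|h|.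
  move=> hd; have := xd' h; rewrite -ball_normE /= sub0r normrN => /(_ hd).
  by rewrite !fctE /= opprD addrA.
pose F y := f (t *: v + y) - f y.
have dF (s : R) : `|s| <= `|t| -> is_derive (s *: u + x) u F
    ('D_u f (t *: v + (s *: u + x)) - 'D_u f (s *: u + x)).
  move=> st; apply: is_deriveB.
    apply: is_derive_translate; apply: derivableP; apply: diff_derivable.
    rewrite addrA; apply: near_f; rewrite (le_lt_trans (norm_tv _ st)) //.
    by rewrite (le_lt_trans _ td) // ler_wpM2l.
  apply: derivableP; apply: diff_derivable; apply: near_f.
  by rewrite (le_lt_trans (norm_su _ st)) // (le_lt_trans _ td) // ler_wpM2l.
have [s|s st] := @MVT_line _ _ F x u t; first by move=> /dF[].
have [_ ->] := dF _ st; rewrite {1 2}/F => ->.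
rewrite -mulrBr normrM ler_wpM2l //.
have dL : 'd ('D_u f) x (t *: v + s *: u) - 'd ('D_u f) x (s *: u) =
    t * 'D_v ('D_u f) x.
  by rewrite linearD addrK linearZ deriveE.
rewrite -dL addrA.
rewrite (_ : _ - _ = ('D_u f (t *: v + s *: u + x) - 'D_u f x
   - 'd ('D_u f) x (t *: v + s *: u)) -
  ('D_u f (s *: u + x) - 'D_u f x - 'd ('D_u f) x (s *: u))); last by ring.
rewrite (le_trans (ler_normB _ _)) //.
apply: (@le_trans _ _ (e / K * (`|t| * (`|u| + `|v|)) + e / K * (`|t| * `|u|))).
  apply: lerD.
    apply: (le_trans (near_o _ _)); last by rewrite ler_wpM2l ?norm_tv // ltW.
    by rewrite (le_lt_trans (norm_tv _ st)) // (le_lt_trans _ td') // ler_wpM2l.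
  apply: (le_trans (near_o _ _)); last by rewrite ler_wpM2l ?norm_su // ltW.
  by rewrite (le_lt_trans (norm_su _ st)) // (le_lt_trans _ td') // ler_wpM2l.
rewrite -mulrDr -mulrDr mulrCA ler_wpM2l // -mulrA ler_piMr ?(ltW e0) //.
by rewrite mulrC ler_pdivrMr // mul1r /K; lra.
Qed.

(** The second difference is symmetric in u and v. At a common small t > 0 both iterated
    derivatives, multiplied by t^2, are within t^2 e / 2 of it. *)
Lemma schwarz f x u v :
  (\forall y \near x, differentiable f y) ->
  differentiable ('D_u f) x -> differentiable ('D_v f) x ->
  'D_v ('D_u f) x = 'D_u ('D_v f) x.
Proof.
move=> df du dv; apply/eqP; rewrite -subr_eq0 -normr_le0; apply/ler_addgt0Pr => e e0.
rewrite add0r.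
have e2 : 0 < e / 2 by rewrite divr_gt0.
have [d /= d0 td] := (nbhs_ballP _ _).1 (second_difference v df du e2).
have [d' /= d'0 td'] := (nbhs_ballP _ _).1 (second_difference u df dv e2).
pose t := Num.min d d' / 2.
have m0 : 0 < Num.min d d' by rewrite lt_min d0.
have t0 : 0 < t by rewrite divr_gt0.
have tm : t < Num.min d d' by rewrite /t; lra.
have /andP[tltd tltd'] : (t < d) && (t < d') by rewrite -lt_min.
have := td t; rewrite -ball_normE /= sub0r normrN (gtr0_norm t0) => /(_ tltd) B1.
have := td' t; rewrite -ball_normE /= sub0r normrN (gtr0_norm t0) => /(_ tltd') B2.
rewrite -(ler_pM2l t0) -(ler_pM2l t0) -[X in X * (X * `|_|)](gtr0_norm t0) -!normrM.
move: B1 B2; rewrite [t *: u + (t *: v + x)]addrCA.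
set D := f (_ + _); set A := 'D_v _ x; set B := 'D_u _ x => B1 B2.
move: A B D (f x) (f (_ + _)) (f (_ + _)) B1 B2 => A B D a b c B1 B2.
have -> : t * (t * (A - B)) =
    (D - b - (c - a) - t * (t * B)) - (D - c - (b - a) - t * (t * A)) by ring.
apply: (le_trans (ler_normB _ _)); apply: (le_trans (lerD B2 B1)).
by rewrite -mulrDr -mulrDr -splitr.
Qed.

End Schwarz.

(** * Derivatives of matrix-valued functions *)

Section MatrixDerivative.
Variables (R : realType) (V : normedModType R).
Implicit Types (x v : V).

Lemma differentiable_bigsum (W : normedModType R) (I : Type) (r : seq I)
    (P : pred I) (F : I -> V -> W) x :
  (forall i, differentiable (F i) x) ->
  differentiable (fun y => \sum_(i <- r | P i) F i y) x.
Proof.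
move=> dF; elim: r => [|i r IHr].
  by under eq_fun do rewrite big_nil; exact: differentiable_cst.
under eq_fun do rewrite big_cons.
by case: (P i) => //; exact: differentiableD.
Qed.

Lemma differentiable_bigprod (I : Type) (r : seq I) (P : pred I)
    (F : I -> V -> R) x :
  (forall i, differentiable (F i) x) ->
  differentiable (fun y => \prod_(i <- r | P i) F i y) x.
Proof.
move=> dF; elim: r => [|i r IHr].
  by under eq_fun do rewrite big_nil; exact: differentiable_cst.
under eq_fun do rewrite big_cons.
by case: (P i) => //; exact: differentiableM.
Qed.

Lemma differentiable_mx m n (M : V -> 'M[R]_(m, n)) x :
  (forall i j, differentiable (fun y => M y i j) x) -> differentiable M x.
Proof.
move=> dM; rewrite (_ : M = fun y => \sum_i \sum_j M y i j *: delta_mx i j).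
  apply: differentiable_bigsum => i; apply: differentiable_bigsum => j.
  exact: differentiableZl.
by apply/funext => y; exact: matrix_sum_delta.
Qed.

Lemma differentiable_mx_coord m n (M : V -> 'M[R]_(m, n)) x i j :
  differentiable M x -> differentiable (fun y => M y i j) x.
Proof.
move=> dM; apply: (@differentiable_comp _ _ _ _ M (fun A => A i j)) => //.
exact: differentiable_coord.
Qed.

Lemma differentiable_det n (M : V -> 'M[R]_n) x :
  (forall i j, differentiable (fun y => M y i j) x) ->
  differentiable (fun y => \det (M y)) x.
Proof.
move=> dM; rewrite /determinant; apply: differentiable_bigsum => s.
apply: differentiableM; first exact: differentiable_cst.
by apply: differentiable_bigprod => i; exact: dM.
Qed.

Lemma differentiable_adj n (M : V -> 'M[R]_n) x : differentiable M x ->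
  differentiable (fun y => \adj (M y)) x.
Proof.
move=> dM; apply: differentiable_mx => i j; under eq_fun do rewrite mxE.
apply: differentiableM; first exact: differentiable_cst.
apply: differentiable_det => k l; under eq_fun do rewrite !mxE.
exact: differentiable_mx_coord.
Qed.

Lemma derive_coord m n (M : V -> 'M[R]_(m, n)) x v i j : differentiable M x ->
  'D_v (fun y => M y i j) x = ('D_v M x) i j.
Proof.
by move=> dM; rewrite derive_mx ?mxE //; exact: diff_derivable.
Qed.

Lemma differentiable_mulmx m n p (A : V -> 'M[R]_(m, n)) (B : V -> 'M[R]_(n, p)) x :
  differentiable A x -> differentiable B x ->
  differentiable (fun y => A y *m B y) x.
Proof.
move=> dA dB; apply: differentiable_mx => i j; under eq_fun do rewrite mxE.
apply: differentiable_bigsum => k.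
by apply: differentiableM; exact: differentiable_mx_coord.
Qed.

Lemma derive_mulmx m n p (A : V -> 'M[R]_(m, n)) (B : V -> 'M[R]_(n, p)) x v :
  differentiable A x -> differentiable B x ->
  'D_v (fun y => A y *m B y) x = 'D_v A x *m B x + A x *m 'D_v B x.
Proof.
move=> dA dB; apply/matrixP => i j.
rewrite -derive_coord; last exact: differentiable_mulmx.
have dAk k : derivable (fun y => A y i k) x v.
  by apply: diff_derivable; exact: differentiable_mx_coord.
have dBk k : derivable (fun y => B y k j) x v.
  by apply: diff_derivable; exact: differentiable_mx_coord.
rewrite (_ : (fun y => _) = \sum_k ((fun y => A y i k) * (fun y => B y k j))).
  rewrite derive_sum => [|k]; last exact: derivableM.
  rewrite !mxE -big_split /=; apply: eq_bigr => k _.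
  by rewrite deriveM // /GRing.scale /= !derive_coord // addrC [B x k j * _]mulrC.
by apply/funext => y; rewrite mxE fct_sumE.
Qed.

End MatrixDerivative.

(** * Trilinearity of the curvature and symmetry of the Ricci tensor *)

Section LeviCivitaCurvature.
Variables (R : realType) (n : nat).
Local Notation V := 'rV[R]_n.
Variables (U : set V) (g : V -> 'M[R]_n).
Hypothesis Uo : open U.
Hypothesis gs : forall y, U y -> (g y)^T = g y.
Hypothesis gu : forall y, U y -> g y \in unitmx.
Hypothesis gC : forall i j, smooth U (fun y => g y i j).

Let nearU y : U y -> \forall z \near y, U z.
Proof. by move=> Uy; exact: open_nbhs_nbhs. Qed.

Let dg k (y : V) : 'M[R]_n :=
  \matrix_(i, j) 'D_(delta_mx 0 k) (fun z => g z i j) y.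
(** The derivative of g along [u] as a combination of partial derivatives, which makes it visibly
    linear in [u]. *)
Let dgv (u y : V) : 'M[R]_n := \sum_k u 0 k *: dg k y.

(* Agrees with [invmx] on [U], but is differentiable without reference to the
   invertibility of nearby matrices. *)
Let ginv (y : V) : 'M[R]_n := (\det (g y))^-1 *: \adj (g y).

(** Christoffel symbols of the first kind. *)
Let low (y u v : V) i : R := 2^-1 * (form (dgv u y) v (delta_mx 0 i)
  + form (dgv v y) u (delta_mx 0 i) - form (dg i y) u v).

(** Equal to [christoffel g] on [U], in a form that shows bilinearity and differentiability. *)
Let Gam (y u v : V) : V := (\row_i low y u v i) *m ginv y.

Let g_coord_diff i j y : U y -> differentiable (fun z => g z i j) y.
Proof. exact: C1_differentiable Uo (gC i j 1) y. Qed.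

Let g_diff y : U y -> differentiable g y.
Proof. by move=> Uy; apply: differentiable_mx => i j; exact: g_coord_diff. Qed.

Let dg_coord_diff k i j y : U y ->
  differentiable ('D_(delta_mx 0 k) (fun z => g z i j)) y.
Proof.
have [_ /(_ k)[_ C1]] := gC i j 2; exact: C1_differentiable Uo C1 y.
Qed.

Let dg_diff k y : U y -> differentiable (dg k) y.
Proof.
move=> Uy; apply: differentiable_mx => i j; under eq_fun do rewrite mxE.
exact: dg_coord_diff.
Qed.

Let derive_sum_coord (f : V -> R) y u : differentiable f y ->
  'D_u f y = \sum_k u 0 k * 'D_(delta_mx 0 k) f y.
Proof.
move=> df; rewrite deriveE // {1}[u]row_sum_delta linear_sum.
by apply: eq_bigr => k _; rewrite linearZ deriveE.
Qed.

Let derive_g u y : U y -> 'D_u g y = dgv u y.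
Proof.
move=> Uy; apply/matrixP => i j; rewrite -derive_coord; last exact: g_diff.
rewrite derive_sum_coord; last exact: g_coord_diff.
by rewrite summxE; apply: eq_bigr => k _; rewrite !mxE.
Qed.

Let derive_form u v w y : U y ->
  'D_u (fun z => form (g z) v w) y = form (dgv u y) v w.
Proof.
move=> Uy; have dgu : derivable g y u by apply: diff_derivable; exact: g_diff.
have := is_derive_form dgu (derivable_cst v y u) (derivable_cst w y u).
rewrite !derive_cst => -[_]; rewrite /= => ->.
by rewrite derive_g // /form !(mul0mx, trmx0, mulmx0) !mxE !addr0.
Qed.

Let ginvE y : U y -> ginv y = invmx (g y).
Proof. by move=> Uy; rewrite /invmx gu. Qed.

Let dgv_delta k y : dgv (delta_mx 0 k) y = dg k y.
Proof.
rewrite /dgv (bigD1 k) //= big1 ?addr0; first by rewrite mxE !eqxx scale1r.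
by move=> i ik; rewrite mxE eqxx /= (negPf ik) scale0r.
Qed.

Let christoffelE' y u v : U y -> christoffel g y u v = Gam y u v.
Proof.
move=> Uy; rewrite /christoffel /sharp /Gam ginvE //; congr (_ *m _).
by apply/rowP => i; rewrite !mxE !derive_form // dgv_delta.
Qed.

Let dgv_linear a u v y : dgv (a *: u + v) y = a *: dgv u y + dgv v y.
Proof.
rewrite /dgv scaler_sumr -big_split /=; apply: eq_bigr => k _.
by rewrite !mxE scalerDl scalerA.
Qed.

Let form_lin1 (A : 'M[R]_n) a u u' v :
  form A (a *: u + u') v = a * form A u v + form A u' v.
Proof. exact: (bilinear2l (form_bilinear A)). Qed.

Let form_lin2 (A : 'M[R]_n) a u v v' :
  form A u (a *: v + v') = a * form A u v + form A u v'.
Proof. exact: (bilinear2r (form_bilinear A)). Qed.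

Let Gam_lin1 y a u u' v : Gam y (a *: u + u') v = a *: Gam y u v + Gam y u' v.
Proof.
rewrite /Gam scalemxAl -mulmxDl; congr (_ *m _); apply/rowP => i.
by rewrite !mxE /low dgv_linear formDm formZm !form_lin1; ring.
Qed.

Let Gam_lin2 y a u v v' : Gam y u (a *: v + v') = a *: Gam y u v + Gam y u v'.
Proof.
rewrite /Gam scalemxAl -mulmxDl; congr (_ *m _); apply/rowP => i.
by rewrite !mxE /low dgv_linear formDm formZm form_lin1 form_lin2; ring.
Qed.

Let dg_sym k y : U y -> (dg k y)^T = dg k y.
Proof.
move=> Uy; apply/matrixP => i j; rewrite !mxE; apply: near_eq_derive.
near=> z; have Uz : U z by near: z; exact: nearU.
by rewrite -[in RHS](gs Uz) mxE.
Unshelve. all: by end_near. Qed.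

Let GamC y u v : U y -> Gam y u v = Gam y v u.
Proof.
move=> Uy; rewrite /Gam; congr (_ *m _); apply/rowP => i; rewrite !mxE /low.
by rewrite (form_sym u v (dg_sym i Uy)); ring.
Qed.

Let form_diff (A : V -> 'M[R]_n) u v y : differentiable A y ->
  differentiable (fun z => form (A z) u v) y.
Proof.
move=> dA; under eq_fun do rewrite formE.
apply: differentiable_bigsum => j; apply: differentiableM; last exact: differentiable_cst.
apply: differentiable_bigsum => i; apply: differentiableM; first exact: differentiable_cst.
exact: differentiable_mx_coord.
Qed.

Let dgv_diff u y : U y -> differentiable (dgv u) y.
Proof.
by move=> Uy; apply: differentiable_bigsum => k; apply: differentiableZ; exact: dg_diff.
Qed.

Let ginv_diff y : U y -> differentiable ginv y.
Proof.
move=> Uy; rewrite /ginv; apply: differentiable_mx => i j.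
under eq_fun do rewrite mxE.
apply: differentiableM.
  apply: differentiableV; last by have := gu Uy; rewrite unitmxE unitfE.
  by apply: differentiable_det => k l; exact: g_coord_diff.
apply: differentiable_mx_coord; apply: differentiable_adj; exact: g_diff.
Qed.

Let Gam_diff u v y : U y -> differentiable (fun z => Gam z u v) y.
Proof.
move=> Uy; apply: differentiable_mulmx; last exact: ginv_diff.
apply: differentiable_mx => i j; under eq_fun do rewrite mxE.
apply: differentiableM; first exact: differentiable_cst.
apply: differentiableB; last by apply: form_diff; exact: dg_diff.
by apply: differentiableD; apply: form_diff; exact: dgv_diff.
Qed.

Let curvE x u v w : U x -> curvature g (cst u) (cst v) (cst w) x =
  'D_u (fun y => Gam y v w) x + Gam x u (Gam x v w)
  - ('D_v (fun y => Gam y u w) x + Gam x v (Gam x u w)).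
Proof.
move=> Ux; rewrite curvature_cst (christoffelE' v w Ux) (christoffelE' u w Ux).
rewrite (christoffelE' u _ Ux) (christoffelE' v _ Ux).
have E s t r : 'D_r (fun y => christoffel g y s t) x = 'D_r (fun y => Gam y s t) x.
  apply: near_eq_derive; near=> z; apply: christoffelE'; near: z; exact: nearU.
by rewrite !E.
Unshelve. all: by end_near. Qed.

Let derive_dir_lin x a u u' v w : U x ->
  'D_(a *: u + u') (fun y => Gam y v w) x =
  a *: 'D_u (fun y => Gam y v w) x + 'D_u' (fun y => Gam y v w) x.
Proof. by move=> Ux; have dG := Gam_diff v w Ux; rewrite !deriveE // linearP. Qed.

Let derive_Gam_lin1 x r a u u' w : U x ->
  'D_r (fun y => Gam y (a *: u + u') w) x =
  a *: 'D_r (fun y => Gam y u w) x + 'D_r (fun y => Gam y u' w) x.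
Proof.
move=> Ux; have dG v : derivable (fun y => Gam y v w) x r.
  by apply: diff_derivable; exact: Gam_diff.
rewrite (_ : (fun y => _) = a *: (fun y => Gam y u w) + (fun y => Gam y u' w)).
  by rewrite deriveD ?deriveZ //; exact: derivableZ.
by apply/funext => y; exact: Gam_lin1.
Qed.

Let derive_Gam_lin2 x r a u v v' : U x ->
  'D_r (fun y => Gam y u (a *: v + v')) x =
  a *: 'D_r (fun y => Gam y u v) x + 'D_r (fun y => Gam y u v') x.
Proof.
move=> Ux; have dG w : derivable (fun y => Gam y u w) x r.
  by apply: diff_derivable; exact: Gam_diff.
rewrite (_ : (fun y => _) = a *: (fun y => Gam y u v) + (fun y => Gam y u v')).
  by rewrite deriveD ?deriveZ //; exact: derivableZ.
by apply/funext => y; exact: Gam_lin2.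
Qed.

(** With this matrix the quadratic term of the Ricci tensor becomes the trace of a product,
    symmetric by [mxtrace_mulC]. *)
Let mx1 x v : 'M[R]_n := \matrix_i Gam x (delta_mx 0 i) v.

Let Gam_mx x u v : Gam x u v = u *m mx1 x v.
Proof.
rewrite {1}[u]row_sum_delta mulmx_sum_row.
elim/big_rec2: _ => [|i a b _ <-]; last by rewrite Gam_lin1 rowK.
by have := Gam_lin1 x (-1) 0 0 v; rewrite scaler0 addr0 scaleN1r addNr.
Qed.

Let ginv_sym y : U y -> (ginv y)^T = ginv y.
Proof. by move=> Uy; rewrite ginvE // trmx_inv gs. Qed.

(** This is the derivative of ln |det g| / 2 along [v]. The other two terms of [low], collected in
    [a], are antisymmetric in i and j and cancel against the symmetric inverse metric. *)
Let trace_Gam y v : U y ->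
  \sum_i Gam y (delta_mx 0 i) v 0 i = 2^-1 * \tr (dgv v y *m ginv y).
Proof.
move=> Uy; pose a i j := (form (dg i y) v (delta_mx 0 j) - form (dg j y) v (delta_mx 0 i)) * ginv y j i.
have -> : \sum_i Gam y (delta_mx 0 i) v 0 i =
    2^-1 * (\sum_i \sum_j a i j + \tr (dgv v y *m ginv y)).
  rewrite mxtrace_mulC [in RHS]mxtrace_mulC /mxtrace -big_split mulr_sumr.
  apply: eq_bigr => i _; rewrite !mxE -big_split mulr_sumr; apply: eq_bigr => j _ /=.
  rewrite mxE /low dgv_delta (form_sym (delta_mx 0 i) v (dg_sym j Uy)).
  by rewrite form_delta /a; ring.
suff : \sum_i \sum_j a i j = - \sum_i \sum_j a i j.
  by move=> aN; congr (_ * _); lra.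
rewrite {1}exchange_big -sumrN; apply: eq_bigr => i _.
rewrite -sumrN; apply: eq_bigr => j _; rewrite /a.
by rewrite -[in LHS](ginv_sym Uy) mxE; ring.
Qed.

Let derive_ginv x v : U x -> 'D_v ginv x = - (ginv x *m dgv v x *m ginv x).
Proof.
move=> Ux; have dgx := g_diff Ux; have dgi := ginv_diff Ux.
have gK : g x \in unitmx by exact: gu.
(* The derivative of the inverse comes from differentiating g g^{-1} = 1, which holds near [x]. *)
have : 'D_v (fun y => g y *m ginv y) x = 0.
  rewrite -(derive_cst (1%:M : 'M[R]_n) x v); apply: near_eq_derive.
  near=> z; have Uz : U z by near: z; exact: nearU.
  by rewrite ginvE // mulmxV // gu.
rewrite derive_mulmx // derive_g // => /(congr1 (mulmx (ginv x))).
rewrite mulmx0 mulmxDr !mulmxA [ginv x *m g x](_ : _ = 1%:M); last first.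
  by rewrite ginvE // mulVmx.
by rewrite mul1mx addrC => /eqP; rewrite addr_eq0 => /eqP.
Unshelve. all: by end_near. Qed.

Let derive_dgv_sym x u v : U x -> 'D_u (dgv v) x = 'D_v (dgv u) x.
Proof.
move=> Ux.
have hess (s t : V) i j : ('D_s (dgv t) x) i j =
    \sum_k t 0 k * \sum_l s 0 l * 'D_(delta_mx 0 l) ('D_(delta_mx 0 k) (fun y => g y i j)) x.
  rewrite -derive_coord; last exact: dgv_diff.
  rewrite (_ : (fun y => _) = \sum_k t 0 k *: 'D_(delta_mx 0 k) (fun y => g y i j)).
    rewrite derive_sum => [|k]; last first.
      by apply: derivableZ; apply: diff_derivable; exact: dg_coord_diff.
    apply: eq_bigr => k _; rewrite deriveZ; last first.
      by apply: diff_derivable; exact: dg_coord_diff.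
    by congr (_ * _); apply: derive_sum_coord; exact: dg_coord_diff.
  by apply/funext => y; rewrite summxE fct_sumE; apply: eq_bigr => k _; rewrite !mxE.
apply/matrixP => i j; rewrite !hess.
have sch k l : 'D_(delta_mx 0 l) ('D_(delta_mx 0 k) (fun y => g y i j)) x =
    'D_(delta_mx 0 k) ('D_(delta_mx 0 l) (fun y => g y i j)) x.
  apply: schwarz; [|exact: dg_coord_diff..].
  by near=> z; apply: g_coord_diff; near: z; exact: nearU.
under eq_bigr do rewrite mulr_sumr; under [RHS]eq_bigr do rewrite mulr_sumr.
rewrite exchange_big /=; apply: eq_bigr => l _; apply: eq_bigr => k _.
by rewrite mulrCA sch.
Unshelve. all: by end_near. Qed.

(** The right-hand side is symmetric in u and v: the first trace by [derive_dgv_sym], the second one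
    by cyclicity. *)
Let derive_trace_Gam x u v : U x ->
  \sum_i ('D_u (fun y => Gam y (delta_mx 0 i) v) x) 0 i =
  2^-1 * (\tr ('D_u (dgv v) x *m ginv x) - \tr (dgv v x *m (ginv x *m dgv u x *m ginv x))).
Proof.
move=> Ux; have dGi i : differentiable (fun y => Gam y (delta_mx 0 i) v 0 i) x.
  by apply: differentiable_mx_coord; exact: Gam_diff.
have dP i j : differentiable (fun y => (dgv v y *m ginv y) i j) x.
  apply: differentiable_mx_coord; apply: differentiable_mulmx.
    exact: dgv_diff.
  exact: ginv_diff.
rewrite -raddfB -mulmxN -derive_ginv // -derive_mulmx; last 2 first.
- exact: dgv_diff.
- exact: ginv_diff.
transitivity ('D_u (fun y => \sum_i Gam y (delta_mx 0 i) v 0 i) x).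
  rewrite (_ : (fun y => _) = \sum_i (fun y => Gam y (delta_mx 0 i) v 0 i)).
    rewrite derive_sum => [|i]; last exact: diff_derivable.
    by apply: eq_bigr => i _; rewrite derive_coord //; exact: Gam_diff.
  by apply/funext => y; rewrite fct_sumE.
rewrite (_ : 'D_u _ x = 'D_u (2^-1 *: \sum_i (fun y => (dgv v y *m ginv y) i i)) x).
  rewrite deriveZ; last by apply: derivable_sum => i; exact: diff_derivable.
  congr (_ * _); rewrite derive_sum => [|i]; last exact: diff_derivable.
  apply: eq_bigr => i _; rewrite derive_coord //.
  by apply: differentiable_mulmx; [exact: dgv_diff|exact: ginv_diff].
apply: near_eq_derive; near=> z; rewrite trace_Gam; last by near: z; exact: nearU.
by rewrite fctE fct_sumE.
Unshelve. all: by end_near. Qed.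

Lemma curvature_ricci_sym x u v : U x ->
  ricci (data_at g x) u v = ricci (data_at g x) v u.
Proof.
move=> Ux.
(* Each group is symmetric in s and t: the first sum by [GamC], the derivative of the trace as noted
   above, the product of matrices by [mxtrace_mulC]. *)
have E s t : ricci (data_at g x) s t =
    \sum_i ('D_(delta_mx 0 i) (fun y => Gam y s t) x + Gam x (delta_mx 0 i) (Gam x s t)) 0 i
    - (2^-1 * (\tr ('D_s (dgv t) x *m ginv x) - \tr (dgv t x *m (ginv x *m dgv s x *m ginv x)))
      + \tr (mx1 x t *m mx1 x s)).
  rewrite /ricci traceE -derive_trace_Gam // /mxtrace -big_split /=.
  rewrite -sumrN -big_split /=; apply: eq_bigr => i _; rewrite curvE //.
  have <- : (Gam x s (Gam x (delta_mx 0 i) t)) 0 i = (mx1 x t *m mx1 x s) i i.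
    by rewrite (GamC s _ Ux) [Gam x (delta_mx 0 i) t]Gam_mx Gam_mx -mulmxA -rowE mxE.
  by rewrite !mxE.
have Eder r : 'D_r (fun y => Gam y u v) x = 'D_r (fun y => Gam y v u) x.
  by apply: near_eq_derive; near=> z; apply: GamC; near: z; exact: nearU.
have Etr : \tr (dgv v x *m (ginv x *m dgv u x *m ginv x)) =
    \tr (dgv u x *m (ginv x *m dgv v x *m ginv x)).
  by rewrite mulmxA mxtrace_mulC !mulmxA mxtrace_mulC !mulmxA.
have Esum :
    \sum_i ('D_(delta_mx 0 i) (fun y => Gam y u v) x
             + Gam x (delta_mx 0 i) (Gam x u v)) 0 i =
    \sum_i ('D_(delta_mx 0 i) (fun y => Gam y v u) x
             + Gam x (delta_mx 0 i) (Gam x v u)) 0 i.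
  by apply: eq_bigr => i _; rewrite Eder (GamC u v Ux).
rewrite (E u v) (E v u) Esum (derive_dgv_sym u v Ux) Etr.
by rewrite (mxtrace_mulC (mx1 x v) (mx1 x u)).
Unshelve. all: by end_near. Qed.

Let scaler_regroup (a : R) (A A' B B' C C' E E' : V) :
  a *: A + A' + (a *: B + B') - (a *: C + C' + (a *: E + E')) =
  a *: (A + B - (C + E)) + (A' + B' - (C' + E')).
Proof. by apply/rowP => i; rewrite !mxE; ring. Qed.

Lemma algebraic_curvature_data_at x : U x -> algebraic_curvature (data_at g x).
Proof.
move=> Ux; split=> [||c u u' v w|c u v v' w|c u v w w'|X Y] /=.
- exact: gs.
- exact: gu.
- rewrite !(curvE _ _ _ Ux) (derive_dir_lin c u u' v w Ux).
  rewrite (derive_Gam_lin1 v c u u' w Ux) !Gam_lin1 Gam_lin2.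
  exact: scaler_regroup.
- rewrite !(curvE _ _ _ Ux) (derive_dir_lin c v v' u w Ux).
  rewrite (derive_Gam_lin1 u c v v' w Ux) !Gam_lin1 Gam_lin2.
  exact: scaler_regroup.
- rewrite !(curvE _ _ _ Ux) (derive_Gam_lin2 u c v w w' Ux).
  rewrite (derive_Gam_lin2 v c u w w' Ux) !Gam_lin2.
  exact: scaler_regroup.
- exact: curvature_ricci_sym.
Qed.

End LeviCivitaCurvature.

Theorem theorem3p4 (R : realType) :
  (forall (n : nat) (M : charted_metric R n), (4 <= n)%N -> semi_riemannian M ->
    [/\ (* (i) *)
        forall p : M, at_point p (fun D =>
          dot D (weyl D) (riem D) + dot D (riem D) (weyl D) =
          dot D (riem D) (riem D) + dot D (weyl D) (weyl D)
          - ((n%:R - 2) ^+ 2)^-1 *: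
            Q (metric D) (- (scal D / (n%:R - 1)) *: wedge (metric D) (ricci D)
                          + wedge (metric D) (ricci2 D))),
        (* (ii) *)
        forall L : M -> R,
          (forall p, U_C M p -> at_point p (fun D =>
            dot D (riem D) (riem D) - Q (ricci D) (riem D) =
            L p *: Q (metric D) (weyl D))) ->
          forall p, U_C M p -> at_point p (fun D =>
            dot D (weyl D) (riem D) + dot D (riem D) (weyl D) =
            Q (ricci D) (weyl D) + L p *: Q (metric D) (weyl D)
            + dot D (weyl D) (weyl D)
            - ((n%:R - 2) ^+ 2)^-1 *:
              Q (metric D) (((n%:R - 2) / 2) *: wedge (ricci D) (ricci D)
                            - scal D *: wedge (metric D) (ricci D)
                            + wedge (metric D) (ricci2 D))),
        (* (iii) *)
        forall L LC : M -> R,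
          (forall p, U_C M p -> at_point p (fun D =>
            dot D (riem D) (riem D) - Q (ricci D) (riem D) =
            L p *: Q (metric D) (weyl D))) ->
          (forall p, U_C M p -> at_point p (fun D =>
            dot D (weyl D) (weyl D) = LC p *: Q (metric D) (weyl D))) ->
          forall p, U_C M p -> at_point p (fun D =>
            dot D (weyl D) (riem D) + dot D (riem D) (weyl D) =
            Q (ricci D) (weyl D) + (L p + LC p) *: Q (metric D) (weyl D)
            - ((n%:R - 2) ^+ 2)^-1 *:
              Q (metric D) (((n%:R - 2) / 2) *: wedge (ricci D) (ricci D)
                            - scal D *: wedge (metric D) (ricci D)
                            + wedge (metric D) (ricci2 D))) &
        (* (iv) *)
        ~ einstein M -> ~ conformally_flat M ->
        forall alpha L LC : M -> R,
          (forall p, (U_S M `&` U_C M) p -> at_point p (fun D =>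
            \rank (form_mx (ricci D - alpha p *: metric D)) = 1%N)) ->
          (forall p, (U_S M `&` U_C M) p -> at_point p (fun D =>
            dot D (riem D) (riem D) - Q (ricci D) (riem D) =
            L p *: Q (metric D) (weyl D))) ->
          (forall p, (U_S M `&` U_C M) p -> at_point p (fun D =>
            dot D (weyl D) (weyl D) = LC p *: Q (metric D) (weyl D))) ->
          forall p, (U_S M `&` U_C M) p -> at_point p (fun D =>
            dot D (weyl D) (riem D) + dot D (riem D) (weyl D) =
            Q (ricci D) (weyl D) + (L p + LC p) *: Q (metric D) (weyl D))]) /\
  (* (v) *)
  (forall a : R, 0 < a -> forall p : goedel a, at_point p (fun D =>
    dot D (weyl D) (riem D) + dot D (riem D) (weyl D) =
    Q (ricci D) (weyl D) + (scal D / 6) *: Q (metric D) (weyl D))).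
Proof.
(* The only chart of [goedel] is the identity, indexed by [tt]. *)
split; last by move=> a a0 p [] _; exact: goedel_dot_sum.
move=> n M n4 [[_ _ _ [charts _] _] [gsym gunit gsm _]].
(* The four claims are now identities at one point in one chart, so it suffices to have algebraic
   curvature data there. *)
have AC (p : M) (i : idx M) : cdom (atlas i) p ->
    algebraic_curvature (data_at (gcomp i) (cmap (atlas i) p)).
  move=> pi; have [_ Uo _ _ _] := charts i.
  apply: (@algebraic_curvature_data_at _ _ (cimg (atlas i))) => //.
  - exact: gsym.
  - exact: gunit.
  - by exists p.
split=> [p i pi|L RR p pC i pi|L LC RR CC p pC i pi|_ _ alpha L LC S1 RR CC p pSC i pi].
- exact: dot_weyl_riem_sum n4 (AC p i pi).
- exact: dot_weyl_riem_sum_Q n4 (AC p i pi) _ (RR p pC i pi).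
- exact: dot_weyl_riem_sum_QQ n4 (AC p i pi) _ (RR p pC i pi) _ (CC p pC i pi).
- exact: dot_weyl_riem_sum_rank1 n4 (AC p i pi) _ (RR p pSC i pi) _
    (CC p pSC i pi) _ (S1 p pSC i pi).
Qed.
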